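(* Let $\mathcal X=\{x_{n,k}: n\in\mathbb N,\ k=1,\dots,L_n\}\subseteq\mathbb T$ be a Marcinkiewicz–Zygmund family with weights $\tau=\{\tau_{n,k}\}$ and constants $0<A\le B$ (as defined in the context), and let $\kappa=B/A$. For a continuous function $f$ on $\mathbb T$ and $n\in\mathbb N$ let $p_n\in\mathcal T_n$ be the solution of the least squares problem $$p_n=\operatorname{argmin}_{p\in\mathcal T_n}\sum_{k=1}^{L_n}|f(x_{n,k})-p(x_{n,k})|^2\tau_{n,k}.$$ (i) If $f\in H^\sigma(\mathbb T)$ with $\sigma>1/2$, then $$\|f-p_n\|_2\le C_\sigma\sqrt{1+\kappa^2}\,\|f\|_{H^\sigma}\,n^{-\sigma+1/2}\quad\text{for all } n\in\mathbb N,$$ with a constant $C_\sigma$ depending only on $\sigma$ (one may take $C_\sigma=(\sigma-1/2)^{-1/2}$). (ii) If $f$ extends to an analytic function on the strip $\{z\in\mathbb C:|\operatorname{Im} z|<\rho_0\}$ for some $\rho_0>0$, then for every $\rho<\rho_0$ one has $\|f-p_n\|_2=\mathcal O(e^{-\rho n})$ as $n\to\infty$.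
   Context: $\mathbb T=\mathbb R/\mathbb Z$, identified with $(-1/2,1/2]$ and equipped with Lebesgue measure; $\|\cdot\|_2$ is the $L^2(\mathbb T)$-norm. $\mathcal T_n$ is the space of trigonometric polynomials $p(x)=\sum_{k=-n}^n c_ke^{2\pi i kx}$ of degree $n$. For $f\in L^2(\mathbb T)$, $\hat f(k)=\int_0^1 f(x)e^{-2\pi ikx}\,dx$. The Sobolev space $H^\sigma(\mathbb T)$ consists of $f$ with $\|f\|_{H^\sigma}=\big(\sum_{k\in\mathbb Z}|\hat f(k)|^2(1+k^2)^\sigma\big)^{1/2}<\infty$. A doubly-indexed set of points $\mathcal X=\{x_{n,k}: n\in\mathbb N, k=1,\dots,L_n\}\subseteq\mathbb T$ with weights $\tau_{n,k}\in(0,\infty)$ is called a Marcinkiewicz–Zygmund family if there exist constants $A,B>0$, independent of $n$, such that $A\|p\|_2^2\le\sum_{k=1}^{L_n}|p(x_{n,k})|^2\tau_{n,k}\le B\|p\|_2^2$ for all $p\in\mathcal T_n$ and all $n\in\mathbb N$. *)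

(* Defs.v *)
From Stdlib Require Import Reals ZArith.
From Coquelicot Require Import Coquelicot.
Open Scope R_scope.

Definition echar (k : Z) (x : R) : C :=
  (cos (2 * PI * IZR k * x), sin (2 * PI * IZR k * x)).

Fixpoint rsum (F : nat -> R) (m : nat) : R :=
  match m with O => 0 | S m' => rsum F m' + F m' end.

Fixpoint csum (F : nat -> C) (m : nat) : C :=
  match m with O => RtoC 0 | S m' => Cplus (csum F m') (F m') end.

Definition trig_poly (n : nat) (c : Z -> C) (x : R) : C :=
  csum (fun j => let k := (Z.of_nat j - Z.of_nat n)%Z in Cmult (c k) (echar k x))
       (2 * n + 1).

Definition in_Tn (n : nat) (p : R -> C) : Prop :=
  exists c : Z -> C, forall x, p x = trig_poly n c x.

(* squared L^2(T) norm and L^2(T) norm, T = R/Z, periodic functions *)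
Definition L2sq (g : R -> C) : R := RInt (fun x => (Cmod (g x)) ^ 2) 0 1.
Definition L2norm (g : R -> C) : R := sqrt (L2sq g).

Definition fourier (f : R -> C) (k : Z) : C :=
  RInt (V := C_R_CompleteNormedModule)
       (fun x => Cmult (f x) (Cconj (echar k x))) 0 1.

(* terms of sum_{k in Z} |\hat f(k)|^2 (1+k^2)^sigma, grouped as k = 0 and
   k = +-(m+1) *)
Definition sob_term (sigma : R) (f : R -> C) (m : nat) : R :=
  match m with
  | O => (Cmod (fourier f 0%Z)) ^ 2
  | S j => ((Cmod (fourier f (Z.of_nat (S j)))) ^ 2
            + (Cmod (fourier f (- Z.of_nat (S j))%Z)) ^ 2)
           * Rpower (1 + (INR (S j)) ^ 2) sigma
  end.

Definition in_Hsigma (sigma : R) (f : R -> C) : Prop := ex_series (sob_term sigma f).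
Definition Hnorm (sigma : R) (f : R -> C) : R := sqrt (Series (sob_term sigma f)).

Definition cont_on_T (f : R -> C) : Prop :=
  (forall x, continuous f x) /\ (forall x, f (x + 1) = f x).

(* weighted discrete sum sum_{k=1}^{L_n} |g(x_{n,k})|^2 tau_{n,k}
   (indices shifted to k = 0 .. L_n - 1) *)
Definition wsum (L : nat -> nat) (X : nat -> nat -> R) (tau : nat -> nat -> R)
  (n : nat) (g : R -> C) : R :=
  rsum (fun k => (Cmod (g (X n k))) ^ 2 * tau n k) (L n).

Definition MZ_family (L : nat -> nat) (X : nat -> nat -> R) (tau : nat -> nat -> R)
  (A B : R) : Prop :=
  0 < A /\ 0 < B /\
  (forall n k, (1 <= n)%nat -> (k < L n)%nat -> -(1/2) < X n k <= 1/2 /\ 0 < tau n k) /\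
  (forall n, (1 <= n)%nat -> forall p, in_Tn n p ->
     A * L2sq p <= wsum L X tau n p /\ wsum L X tau n p <= B * L2sq p).

Definition LS_solution (L : nat -> nat) (X : nat -> nat -> R) (tau : nat -> nat -> R)
  (f : R -> C) (n : nat) (p : R -> C) : Prop :=
  in_Tn n p /\
  forall q, in_Tn n q ->
    wsum L X tau n (fun x => Cminus (f x) (p x)) <= wsum L X tau n (fun x => Cminus (f x) (q x)).

Definition analytic_strip (f : R -> C) (rho0 : R) : Prop :=
  exists F : C -> C,
    (forall z : C, Rabs (Im z) < rho0 -> ex_derive (K := C_AbsRing) (V := C_NormedModule) F z) /\
    (forall t : R, F (RtoC t) = f t).

(* Main.v *)
(* For the Fourier partial sum q of f, the least squares variational inequality gives
   W(q - p_n) <= W(f - q) for the weighted discrete sum W, so by the Marcinkiewicz-Zygmund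
   inequalities and Pythagoras |f - p_n|_2^2 <= (1 + B/A) sup |f - q|^2, where A <= B.
   The sup norm of a continuous function is at most the l^1 norm of its Fourier coefficients,
   as one sees by integrating against powers of (1 + cos 2 pi (x - x0)) / 2, so everything
   reduces to the tails of sum |fhat k|. In (i) they are bounded by Cauchy-Schwarz; in (ii)
   Goursat's theorem on a rectangle shifts the contour and gives fhat k = O(e^(-2 pi y |k|))
   for all y < rho0. The vertical sides cancel because the holomorphic extension of f inherits
   its period, by a unique continuation argument on circles. *)
Require Import Defs.
From Stdlib Require Import Reals ZArith Lra Lia.
From Coquelicot Require Import Coquelicot.
Open Scope R_scope.

(** * Complex-valued integrals and Fourier coefficients *)

(** The sup bound by the [l^1] norm of the coefficients takes the place of any convergence theorem
    for Fourier series. It rests on the positive kernel [h^m], where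
    [h = (1 + cos 2 pi (x - x0)) / 2]. Positivity bounds every coefficient of [h^m] by its integral
    [I]; the value 1 at [x0], a sum of [2m + 1] such coefficients, then forces [I >= 1 / (2m + 1)].
    Away from [x0] the kernel is at most [q^m] with [q < 1], and this geometric decay beats the
    linear loss. When all coefficients vanish, the same bound is the uniqueness theorem for Fourier
    coefficients, and in that form it also drives the unique continuation argument.

    The obstacle in (ii) is that the extension is only known to agree with [f] on the real line: its
    periodicity has to be proved, and it may be unbounded near the edge of the strip. Hence the
    contour stays at a fixed height [y < rho0]. Since the period is 1, the rate obtained is
    [2 pi y], which leaves room for any [rho < rho0]. *)

Notation CInt g a b := (RInt (V := C_R_CompleteNormedModule) g a b).
Notation Ccont := (@continuous R_UniformSpace C_UniformSpace).

Lemma Ccont_pair (g : R -> C) x :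
  continuous (fun t => fst (g t)) x -> continuous (fun t => snd (g t)) x -> Ccont g x.
Proof.
  intros H1 H2.
  apply continuous_ext with (fun t => (fst (g t), snd (g t))).
  { intros t; now destruct (g t). }
  apply (continuous_comp_2 (fun t => fst (g t)) (fun t => snd (g t)) (fun a b => (a, b)) x H1 H2).
  apply continuous_ext with (fun u : R * R => u).
  { intros [a b]; reflexivity. }
  apply continuous_id.
Qed.

Lemma Ccont_fst (g : R -> C) x : Ccont g x -> continuous (fun t => fst (g t)) x.
Proof.
  intros H. apply (continuous_comp g fst x H).
  destruct (g x) as [a b]. apply (continuous_fst a b).
Qed.

Lemma Ccont_snd (g : R -> C) x : Ccont g x -> continuous (fun t => snd (g t)) x.
Proof.
  intros H. apply (continuous_comp g snd x H).
  destruct (g x) as [a b]. apply (continuous_snd a b).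
Qed.

Lemma Rcont_mult (f g : R -> R) x :
  continuous f x -> continuous g x -> continuous (fun t => f t * g t) x.
Proof. intros; now apply (continuous_mult (K := R_AbsRing) f g). Qed.
Lemma Rcont_plus (f g : R -> R) x :
  continuous f x -> continuous g x -> continuous (fun t => f t + g t) x.
Proof. intros; now apply (continuous_plus (V := R_NormedModule) f g). Qed.
Lemma Rcont_minus (f g : R -> R) x :
  continuous f x -> continuous g x -> continuous (fun t => f t - g t) x.
Proof. intros; now apply (continuous_minus (V := R_NormedModule) f g). Qed.

Ltac rcont := repeat match goal with
  | |- continuous (fun t => (@?a t) * (@?b t)) _ => apply (Rcont_mult a b)
  | |- continuous (fun t => (@?a t) + (@?b t)) _ => apply (Rcont_plus a b)
  | |- continuous (fun t => (@?a t) - (@?b t)) _ => apply (Rcont_minus a b)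
  | |- continuous (fun t => - (@?a t)) _ => apply (continuous_opp (V := R_NormedModule) a)
  | |- continuous (fun _ => ?c) _ => apply continuous_const
  | |- continuous (fun t => fst (@?a t)) _ => apply (Ccont_fst a)
  | |- continuous (fun t => snd (@?a t)) _ => apply (Ccont_snd a)
  | |- _ => solve [auto]
  end.

Lemma Ccont_const (c : C) x : Ccont (fun _ => c) x.
Proof. apply continuous_const. Qed.

Lemma Ccont_plus (f g : R -> C) x :
  Ccont f x -> Ccont g x -> Ccont (fun t => Cplus (f t) (g t)) x.
Proof.
  intros; apply Ccont_pair; simpl; rcont.
Qed.

Lemma Ccont_minus (f g : R -> C) x :
  Ccont f x -> Ccont g x -> Ccont (fun t => Cminus (f t) (g t)) x.
Proof.
  intros; apply Ccont_pair; simpl; rcont.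
Qed.

Lemma Ccont_mult (f g : R -> C) x :
  Ccont f x -> Ccont g x -> Ccont (fun t => Cmult (f t) (g t)) x.
Proof.
  intros; apply Ccont_pair; simpl; rcont.
Qed.

Lemma Ccont_conj (f : R -> C) x : Ccont f x -> Ccont (fun t => Cconj (f t)) x.
Proof.
  intros; apply Ccont_pair; simpl. now apply Ccont_fst.
  apply (continuous_opp (V := R_NormedModule)). now apply Ccont_snd.
Qed.

Lemma Ccont_RtoC (f : R -> R) x : continuous f x -> Ccont (fun t => RtoC (f t)) x.
Proof. intros; apply Ccont_pair; simpl; auto. apply continuous_const. Qed.

Lemma continuous_Cmod (f : R -> C) x : Ccont f x -> continuous (fun t => Cmod (f t)) x.
Proof.
  intros H. unfold Cmod.
  apply (continuous_comp (fun t => fst (f t) ^ 2 + snd (f t) ^ 2) sqrt).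
  - simpl. rcont.
  - apply continuity_pt_filterlim, continuity_pt_sqrt.
    nra.
Qed.

Lemma continuous_Cmod2 (f : R -> C) x : Ccont f x -> continuous (fun t => Cmod (f t) ^ 2) x.
Proof.
  intros H. simpl. apply (continuous_Cmod f x) in H. rcont.
Qed.

Lemma Cmod2 (z : C) : Cmod z ^ 2 = fst z ^ 2 + snd z ^ 2.
Proof. unfold Cmod. rewrite pow2_sqrt; nra. Qed.

Lemma Cminus_0 (z w : C) : Cminus z w = RtoC 0 -> z = w.
Proof. intros H. replace z with (Cplus (Cminus z w) w) by ring. rewrite H. ring. Qed.

Lemma ex_CInt (g : R -> C) a b :
  (forall x, Rmin a b <= x <= Rmax a b -> Ccont g x) ->
  ex_RInt (V := C_R_NormedModule) g a b.
Proof. intros H. now apply (ex_RInt_continuous (V := C_R_CompleteNormedModule)). Qed.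

(** Bridge to two real integrals, through which explicit antiderivatives and complex factors are
    handled coordinatewise. *)
Lemma CInt_eq (g : R -> C) a b :
  (forall x, Rmin a b <= x <= Rmax a b -> Ccont g x) ->
  CInt g a b = (RInt (fun t => fst (g t)) a b, RInt (fun t => snd (g t)) a b).
Proof.
  intros H. apply is_RInt_unique.
  apply (is_RInt_fct_extend_pair (U := R_NormedModule) (V := R_NormedModule));
   apply (RInt_correct (V := R_CompleteNormedModule));
   apply (ex_RInt_continuous (V := R_CompleteNormedModule)); intros x Hx.
  now apply Ccont_fst, H. now apply Ccont_snd, H.
Qed.

Lemma CInt_plus (f g : R -> C) a b :
  (forall x, Rmin a b <= x <= Rmax a b -> Ccont f x) ->
  (forall x, Rmin a b <= x <= Rmax a b -> Ccont g x) ->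
  CInt (fun t => Cplus (f t) (g t)) a b = Cplus (CInt f a b) (CInt g a b).
Proof.
  intros; apply (RInt_plus (V := C_R_CompleteNormedModule)); now apply ex_CInt.
Qed.

Lemma CInt_minus (f g : R -> C) a b :
  (forall x, Rmin a b <= x <= Rmax a b -> Ccont f x) ->
  (forall x, Rmin a b <= x <= Rmax a b -> Ccont g x) ->
  CInt (fun t => Cminus (f t) (g t)) a b = Cminus (CInt f a b) (CInt g a b).
Proof.
  intros; apply (RInt_minus (V := C_R_CompleteNormedModule)); now apply ex_CInt.
Qed.

(** Restates an equation over a canonical-structure carrier as one over [R], the form that [ring]
    recognises. *)
Ltac eqR := match goal with |- @eq _ ?a ?b => change (@eq R a b) end.

Lemma RInt_ext_R (f g : R -> R) a b : (forall x, f x = g x) -> RInt f a b = RInt g a b.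
Proof. intros H; apply RInt_ext; auto. Qed.

Lemma CInt_ext (f g : R -> C) a b : (forall x, f x = g x) -> CInt f a b = CInt g a b.
Proof. intros H; apply RInt_ext; auto. Qed.

Lemma RInt_lin2 (f g : R -> R) (u v : R) a b :
  (forall x, Rmin a b <= x <= Rmax a b -> continuous f x) ->
  (forall x, Rmin a b <= x <= Rmax a b -> continuous g x) ->
  RInt (fun t => u * f t + v * g t) a b = u * RInt f a b + v * RInt g a b.
Proof.
  intros Hf Hg.
  assert (ef := ex_RInt_continuous (V := R_CompleteNormedModule) f a b Hf).
  assert (eg := ex_RInt_continuous (V := R_CompleteNormedModule) g a b Hg).
  assert (Ef := RInt_scal (V := R_CompleteNormedModule) f a b u ef).
  assert (Eg := RInt_scal (V := R_CompleteNormedModule) g a b v eg).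
  unfold scal in Ef, Eg; simpl in Ef, Eg; unfold mult in Ef, Eg; simpl in Ef, Eg.
  rewrite <- Ef, <- Eg.
  apply (RInt_plus (V := R_CompleteNormedModule) (fun t => u * f t) (fun t => v * g t));
   [exact (ex_RInt_scal f a b u ef) | exact (ex_RInt_scal g a b v eg)].
Qed.

(** The integral takes values in [C] as a real vector space, so its linearity is real; a complex
    factor mixes the two coordinates, each of which becomes a real linear combination. *)
Lemma CInt_scal (c : C) (f : R -> C) a b :
  (forall x, Rmin a b <= x <= Rmax a b -> Ccont f x) ->
  CInt (fun t => Cmult c (f t)) a b = Cmult c (CInt f a b).
Proof.
  intros Hf. rewrite (CInt_eq f) by auto.
  rewrite CInt_eq by (intros; apply Ccont_mult; [apply Ccont_const|auto]).
  unfold Cmult; simpl. f_equal.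
  - transitivity (RInt (fun t => fst c * fst (f t) + (- snd c) * snd (f t)) a b).
    { apply RInt_ext_R; intros; ring. }
    rewrite RInt_lin2; [eqR; ring | |]; intros; [apply Ccont_fst | apply Ccont_snd]; auto.
  - rewrite RInt_lin2; [eqR; ring | |]; intros; [apply Ccont_snd | apply Ccont_fst]; auto.
Qed.

Lemma CInt_RtoC (f : R -> R) a b :
  (forall x, Rmin a b <= x <= Rmax a b -> continuous f x) ->
  CInt (fun t => RtoC (f t)) a b = RtoC (RInt f a b).
Proof.
  intros Hf. rewrite CInt_eq by (intros; now apply Ccont_RtoC, Hf).
  simpl. unfold RtoC. f_equal. rewrite RInt_const. apply (Rmult_0_r (b - a)).
Qed.

Lemma Cmod_CInt_le (f : R -> C) (g : R -> R) (a b : R) : a <= b ->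
  (forall x, a <= x <= b -> Ccont f x) ->
  (forall x, a <= x <= b -> continuous g x) ->
  (forall x, a <= x <= b -> Cmod (f x) <= g x) ->
  Cmod (CInt f a b) <= RInt g a b.
Proof.
  intros Hab Hf Hg H. rewrite Cmod_norm.
  apply (norm_RInt_le (V := C_R_NormedModule) f g a b); auto.
  - intros x Hx. rewrite <- Cmod_norm. auto.
  - apply (RInt_correct (V := C_R_CompleteNormedModule)), ex_CInt.
    rewrite Rmin_left, Rmax_right by auto. auto.
  - apply (RInt_correct (V := R_CompleteNormedModule)),
     (ex_RInt_continuous (V := R_CompleteNormedModule)).
    rewrite Rmin_left, Rmax_right by auto. auto.
Qed.

(** A Riemann integrable function is bounded, so the bound is read off from integrability. *)
Lemma continuous_bounded (f : R -> C) a b :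
  (forall x, Rmin a b <= x <= Rmax a b -> Ccont f x) ->
  exists M, forall t, Rmin a b <= t <= Rmax a b -> Cmod (f t) <= M.
Proof.
  intros H. destruct (ex_RInt_ub (V := C_R_NormedModule) f a b (ex_CInt f a b H)) as [M HM].
  exists M. intros t Ht. rewrite Cmod_norm. auto.
Qed.

Lemma continuous_cos_lin (u v x : R) : continuous (fun t => cos (u * t + v)) x.
Proof. apply (ex_derive_continuous (V := R_NormedModule)). auto_derive. auto. Qed.
Lemma continuous_sin_lin (u v x : R) : continuous (fun t => sin (u * t + v)) x.
Proof. apply (ex_derive_continuous (V := R_NormedModule)). auto_derive. auto. Qed.

Lemma Ccont_echar k x : Ccont (echar k) x.
Proof.
  apply Ccont_pair; simpl.
  - apply continuous_ext with (fun t => cos (2 * PI * IZR k * t + 0)).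
    intros; f_equal; ring. apply continuous_cos_lin.
  - apply continuous_ext with (fun t => sin (2 * PI * IZR k * t + 0)).
    intros; f_equal; ring. apply continuous_sin_lin.
Qed.

Ltac ccont := repeat match goal with
  | |- continuous (fun t => Cmult (@?a t) (@?b t)) _ => apply (Ccont_mult a b)
  | |- continuous (fun t => Cplus (@?a t) (@?b t)) _ => apply (Ccont_plus a b)
  | |- continuous (fun t => Cminus (@?a t) (@?b t)) _ => apply (Ccont_minus a b)
  | |- continuous (fun t => Cconj (@?a t)) _ => apply (Ccont_conj a)
  | |- continuous (fun t => RtoC (@?a t)) _ => apply (Ccont_RtoC a)
  | |- continuous (fun t => echar ?k t) _ => apply (Ccont_echar k)
  | |- continuous (echar ?k) _ => apply (Ccont_echar k)
  | |- continuous (fun _ => ?c) _ => apply continuous_const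
  | |- _ => solve [auto]
  end.

(** * Characters of the circle and their orthonormality *)

Lemma echar_0 x : echar 0 x = RtoC 1.
Proof.
  unfold echar, RtoC. replace (2 * PI * 0 * x) with 0 by ring. now rewrite cos_0, sin_0.
Qed.

Lemma echar_add k l x : echar (k + l) x = Cmult (echar k x) (echar l x).
Proof.
  unfold echar, Cmult; simpl. rewrite plus_IZR.
  replace (2 * PI * (IZR k + IZR l) * x) with (2 * PI * IZR k * x + 2 * PI * IZR l * x) by ring.
  rewrite cos_plus, sin_plus. f_equal. ring.
Qed.

Lemma echar_opp k x : echar (- k) x = Cconj (echar k x).
Proof.
  unfold echar, Cconj; simpl. rewrite opp_IZR.
  replace (2 * PI * - IZR k * x) with (- (2 * PI * IZR k * x)) by ring.
  now rewrite cos_neg, sin_neg.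
Qed.

Lemma echar_add_arg k x y : echar k (x + y) = Cmult (echar k x) (echar k y).
Proof.
  unfold echar, Cmult; simpl.
  replace (2 * PI * IZR k * (x + y)) with (2 * PI * IZR k * x + 2 * PI * IZR k * y) by ring.
  rewrite cos_plus, sin_plus. f_equal. ring.
Qed.

Lemma echar_opp_arg k x : echar k (- x) = Cconj (echar k x).
Proof.
  unfold echar, Cconj; simpl. replace (2 * PI * IZR k * - x) with (- (2 * PI * IZR k * x)) by ring.
  now rewrite cos_neg, sin_neg.
Qed.

Lemma Cmod_echar k x : Cmod (echar k x) = 1.
Proof.
  unfold Cmod, echar; simpl. transitivity (sqrt 1); [f_equal | apply sqrt_1].
  generalize (sin2_cos2 (2 * PI * IZR k * x)). unfold Rsqr. lra.
Qed.

Lemma sin_cos_2PI_IZR (k : Z) : cos (2 * PI * IZR k) = 1 /\ sin (2 * PI * IZR k) = 0.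
Proof.
  assert (H : forall n : nat, cos (2 * PI * INR n) = 1 /\ sin (2 * PI * INR n) = 0).
  { intros n. generalize (cos_period 0 n), (sin_period 0 n).
    replace (0 + 2 * INR n * PI) with (2 * PI * INR n) by ring.
    rewrite cos_0, sin_0. auto. }
  destruct (Z_le_gt_dec 0 k) as [Hk|Hk].
  - rewrite <- (Z2Nat.id k) by lia. rewrite <- INR_IZR_INZ. apply H.
  - replace k with (- Z.of_nat (Z.to_nat (- k)))%Z by lia.
    rewrite opp_IZR, <- INR_IZR_INZ, Ropp_mult_distr_r_reverse, cos_neg, sin_neg.
    destruct (H (Z.to_nat (- k))) as [-> ->]. lra.
Qed.

Lemma echar_period k x : echar k (x + 1) = echar k x.
Proof.
  rewrite echar_add_arg. unfold echar at 2. rewrite Rmult_1_r.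
  destruct (sin_cos_2PI_IZR k) as [-> ->]. change (1, 0) with (RtoC 1). ring.
Qed.

Lemma CInt_echar k : k <> 0%Z -> CInt (echar k) 0 1 = RtoC 0.
Proof.
  intros Hk. assert (Hk' : IZR k <> 0) by now apply not_0_IZR.
  assert (HP := PI_neq0).
  destruct (sin_cos_2PI_IZR k) as [Hc Hs].
  rewrite CInt_eq by (intros; apply Ccont_echar).
  unfold echar, RtoC; simpl. f_equal; apply is_RInt_unique.
  - evar_last.
    apply (is_RInt_derive (V := R_CompleteNormedModule)
      (fun t => sin (2 * PI * IZR k * t) / (2 * PI * IZR k))
      (fun t => cos (2 * PI * IZR k * t))).
    + intros x _. auto_derive; auto. field. split; auto with real.
    + intros x _. apply (Ccont_fst (echar k)), Ccont_echar.
    + unfold minus, plus, opp; simpl. rewrite Rmult_1_r, Rmult_0_r, sin_0, Hs. field; split; auto with real.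
  - evar_last.
    apply (is_RInt_derive (V := R_CompleteNormedModule)
      (fun t => - cos (2 * PI * IZR k * t) / (2 * PI * IZR k))
      (fun t => sin (2 * PI * IZR k * t))).
    + intros x _. auto_derive; auto. field. split; auto with real.
    + intros x _. apply (Ccont_snd (echar k)), Ccont_echar.
    + unfold minus, plus, opp; simpl. rewrite Rmult_1_r, Rmult_0_r, cos_0, Hc. field; split; auto with real.
Qed.

Lemma fourier_echar k l : fourier (echar k) l = RtoC (if Z.eq_dec k l then 1 else 0).
Proof.
  unfold fourier.
  rewrite (CInt_ext _ (echar (k - l))).
  2:{ intros x. unfold Z.sub. now rewrite echar_add, echar_opp. }
  destruct Z.eq_dec as [->|H].
  - rewrite Z.sub_diag.
    rewrite (CInt_ext _ (fun _ => RtoC 1)) by (intros; apply echar_0).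
    rewrite (RInt_const (V := C_R_CompleteNormedModule)).
    unfold scal; simpl; unfold prod_scal, scal; simpl; unfold mult, RtoC; simpl. f_equal; ring.
  - apply CInt_echar. lia.
Qed.

(** * Symmetric sums over the integers and trigonometric polynomials *)

Fixpoint zsumC (F : Z -> C) (n : nat) : C :=
  match n with
  | O => F 0%Z
  | S m => Cplus (zsumC F m) (Cplus (F (Z.of_nat n)) (F (- Z.of_nat n)%Z))
  end.

Fixpoint zsumR (F : Z -> R) (n : nat) : R :=
  match n with
  | O => F 0%Z
  | S m => zsumR F m + (F (Z.of_nat n) + F (- Z.of_nat n)%Z)
  end.

Lemma csum_ext F G m : (forall j, (j < m)%nat -> F j = G j) -> csum F m = csum G m.
Proof. induction m; intros H; simpl; auto. rewrite IHm, H; auto. Qed.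

Lemma csum_S_l F m : csum F (S m) = Cplus (F O) (csum (fun j => F (S j)) m).
Proof.
  induction m. simpl; ring.
  change (csum F (S (S m))) with (Cplus (csum F (S m)) (F (S m))). rewrite IHm. simpl. ring.
Qed.

(** In the list form, passing from [n] to [n + 1] adds a term at each end and shifts every index.
    The symmetric form grows by the pair [n + 1], [- n - 1] only, and later inductions run on it. *)
Lemma csum_zsum F n : csum (fun j => F (Z.of_nat j - Z.of_nat n)%Z) (2 * n + 1) = zsumC F n.
Proof.
  induction n. simpl; ring.
  replace (2 * S n + 1)%nat with (S (S (2 * n + 1))) by lia.
  rewrite csum_S_l. cbn [csum zsumC]. rewrite <- IHn.
  rewrite (csum_ext (fun j => F (Z.of_nat (S j) - Z.of_nat (S n))%Z)
     (fun j => F (Z.of_nat j - Z.of_nat n)%Z)) by (intros; f_equal; lia).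
  replace (Z.of_nat 0 - Z.of_nat (S n))%Z with (- Z.of_nat (S n))%Z by lia.
  replace (Z.of_nat (S (2 * n + 1)) - Z.of_nat (S n))%Z with (Z.of_nat (S n))%Z by lia.
  ring.
Qed.

Lemma trig_poly_zsum n c x : trig_poly n c x = zsumC (fun k => Cmult (c k) (echar k x)) n.
Proof. apply (csum_zsum (fun k => Cmult (c k) (echar k x))). Qed.

Lemma zsumC_ext F G n : (forall k, (Z.abs k <= Z.of_nat n)%Z -> F k = G k) -> zsumC F n = zsumC G n.
Proof.
  induction n; intros H; simpl zsumC.
  - apply H; lia.
  - rewrite IHn. 2: intros; apply H; lia. now rewrite !H by lia.
Qed.

Lemma zsumC_plus F G n : zsumC (fun k => Cplus (F k) (G k)) n = Cplus (zsumC F n) (zsumC G n).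
Proof. induction n; cbn [zsumC]; auto. rewrite IHn. ring. Qed.

Lemma zsumC_minus F G n : zsumC (fun k => Cminus (F k) (G k)) n = Cminus (zsumC F n) (zsumC G n).
Proof. induction n; cbn [zsumC]; auto. rewrite IHn. ring. Qed.

Lemma zsumC_scal c F n : zsumC (fun k => Cmult c (F k)) n = Cmult c (zsumC F n).
Proof. induction n; cbn [zsumC]; auto. rewrite IHn. ring. Qed.

(** Shifting the window trades the term at one end for the next one beyond the other end. It is
    applied where both of these vanish. *)
Lemma zsumC_pred F n :
  zsumC (fun k => F (k - 1)%Z) n = Cplus (Cminus (zsumC F n) (F (Z.of_nat n))) (F (- Z.of_nat n - 1)%Z).
Proof.
  induction n; cbn [zsumC]. simpl; ring.
  rewrite IHn. replace (Z.of_nat (S n) - 1)%Z with (Z.of_nat n) by lia.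
  replace (- Z.of_nat n - 1)%Z with (- Z.of_nat (S n))%Z by lia. ring.
Qed.

Lemma zsumC_succ F n :
  zsumC (fun k => F (k + 1)%Z) n = Cplus (Cminus (zsumC F n) (F (- Z.of_nat n)%Z)) (F (Z.of_nat n + 1)%Z).
Proof.
  induction n; cbn [zsumC]. simpl; ring.
  rewrite IHn. replace (- Z.of_nat (S n) + 1)%Z with (- Z.of_nat n)%Z by lia.
  replace (Z.of_nat n + 1)%Z with (Z.of_nat (S n)) by lia. ring.
Qed.

Lemma Cmod_zsumC_le F n : Cmod (zsumC F n) <= zsumR (fun k => Cmod (F k)) n.
Proof.
  induction n; cbn [zsumC zsumR]. lra.
  eapply Rle_trans. apply Cmod_triangle. apply Rplus_le_compat; auto. apply Cmod_triangle.
Qed.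

Lemma zsumR_le F G n :
  (forall k, (Z.abs k <= Z.of_nat n)%Z -> F k <= G k) -> zsumR F n <= zsumR G n.
Proof.
  induction n; intros H; simpl zsumR. apply H; lia.
  apply Rplus_le_compat. apply IHn; intros; apply H; lia.
  apply Rplus_le_compat; apply H; lia.
Qed.

Lemma zsumR_scal c F n : zsumR (fun k => c * F k) n = c * zsumR F n.
Proof. induction n; cbn [zsumR]; auto. rewrite IHn. ring. Qed.

Lemma zsumR_opp F n : zsumR (fun k => F (- k)%Z) n = zsumR F n.
Proof. induction n; cbn [zsumR]; auto. rewrite IHn, Z.opp_involutive. ring. Qed.

Lemma zsumR_const c n : zsumR (fun _ => c) n = (2 * INR n + 1) * c.
Proof. induction n; cbn [zsumR]. simpl; ring. rewrite IHn, S_INR. ring. Qed.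

Lemma zsumC_delta (c : Z -> C) l n :
  zsumC (fun k => Cmult (c k) (RtoC (if Z.eq_dec k l then 1 else 0))) n
  = if Z_le_dec (Z.abs l) (Z.of_nat n) then c l else RtoC 0.
Proof.
  induction n.
  - cbn [zsumC]. destruct (Z.eq_dec 0 l); destruct Z_le_dec; try lia; subst; ring.
  - cbn [zsumC]. rewrite IHn.
    destruct (Z.eq_dec (Z.of_nat (S n)) l); destruct (Z.eq_dec (- Z.of_nat (S n)) l);
    destruct Z_le_dec; destruct Z_le_dec; try lia; subst; ring.
Qed.

Lemma Ccont_zsum (F : Z -> R -> C) n x :
  (forall k, Ccont (F k) x) -> Ccont (fun t => zsumC (fun k => F k t) n) x.
Proof.
  intros H; induction n; cbn [zsumC]. apply H.
  apply Ccont_plus; [exact IHn | apply Ccont_plus; apply H].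
Qed.

Lemma CInt_zsum (F : Z -> R -> C) n a b :
  (forall k x, Ccont (F k) x) ->
  CInt (fun t => zsumC (fun k => F k t) n) a b = zsumC (fun k => CInt (F k) a b) n.
Proof.
  intros H; induction n; cbn [zsumC]; [reflexivity|].
  rewrite (CInt_plus (fun t => zsumC (fun k => F k t) n)
    (fun t => Cplus (F (Z.of_nat (S n)) t) (F (- Z.of_nat (S n))%Z t))), IHn.
  rewrite (CInt_plus (F (Z.of_nat (S n))) (F (- Z.of_nat (S n))%Z)).
  reflexivity.
  all: intros; match goal with
    | |- continuous (fun t => zsumC _ _) _ => now apply Ccont_zsum
    | |- continuous (fun t => Cplus _ _) _ => apply Ccont_plus; apply H
    | _ => apply H
    end.
Qed.

Lemma Ccont_trig_poly n c x : Ccont (trig_poly n c) x.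
Proof.
  apply continuous_ext with (fun t => zsumC (fun k => Cmult (c k) (echar k t)) n).
  intros; symmetry; apply trig_poly_zsum.
  apply (Ccont_zsum (fun k t => Cmult (c k) (echar k t))).
  intros; apply Ccont_mult. apply Ccont_const. apply Ccont_echar.
Qed.

Lemma Ccont_ext (f g : R -> C) x : (forall t, f t = g t) -> Ccont f x -> Ccont g x.
Proof. intros H; now apply continuous_ext. Qed.

Lemma fourier_trig_poly n c l :
  fourier (trig_poly n c) l = if Z_le_dec (Z.abs l) (Z.of_nat n) then c l else RtoC 0.
Proof.
  rewrite <- zsumC_delta. unfold fourier.
  rewrite (CInt_ext _
    (fun t => zsumC (fun k => Cmult (c k) (Cmult (echar k t) (Cconj (echar l t)))) n)).
  2:{ intros x. rewrite trig_poly_zsum, Cmult_comm, <- zsumC_scal.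
      apply zsumC_ext; intros; ring. }
  rewrite (CInt_zsum (fun k t => Cmult (c k) (Cmult (echar k t) (Cconj (echar l t))))).
  2:{ intros; ccont. }
  apply zsumC_ext. intros k _.
  rewrite CInt_scal.
  2:{ intros; ccont. }
  f_equal. apply fourier_echar.
Qed.

Lemma fourier_minus f g k :
  (forall x, Ccont f x) -> (forall x, Ccont g x) ->
  fourier (fun x => Cminus (f x) (g x)) k = Cminus (fourier f k) (fourier g k).
Proof.
  intros Hf Hg. unfold fourier. rewrite <- CInt_minus.
  - apply CInt_ext. intros; unfold Cminus. ring.
  - intros; apply Ccont_mult; auto. apply Ccont_conj, Ccont_echar.
  - intros; apply Ccont_mult; auto. apply Ccont_conj, Ccont_echar.
Qed.

(** * The sup norm and the Fourier coefficients *)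

(** This is [cos^2 (pi (x - x0))]: a trigonometric polynomial of degree 1 with values in [0, 1] that
    reaches 1 only at [x0] modulo 1, so that its powers concentrate there. *)
Definition havercos (x0 x : R) : R := (1 + cos (2 * PI * (x - x0))) / 2.

Lemma havercos_bounds x0 x : 0 <= havercos x0 x <= 1.
Proof. unfold havercos. generalize (COS_bound (2 * PI * (x - x0))). lra. Qed.

Lemma continuous_havercos_pow x0 m x : continuous (fun t => havercos x0 t ^ m) x.
Proof.
  apply (ex_derive_continuous (V := R_NormedModule)). unfold havercos. auto_derive. auto.
Qed.

Lemma havercos_echar x0 x :
  RtoC (havercos x0 x) = Cplus (RtoC (1/2))
    (Cplus (Cmult (Cmult (RtoC (1/4)) (Cconj (echar 1 x0))) (echar 1 x))
           (Cmult (Cmult (RtoC (1/4)) (echar 1 x0)) (echar (-1) x))).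
Proof.
  change (-1)%Z with (- (1))%Z. rewrite echar_opp.
  unfold havercos, echar, Cmult, Cplus, Cconj, RtoC; simpl.
  replace (2 * PI * (x - x0)) with (2 * PI * 1 * x - 2 * PI * 1 * x0) by ring.
  rewrite cos_minus. f_equal; field.
Qed.

(** Multiplication by a polynomial of degree 1 acts on coefficients as a three-term convolution. The
    support condition is carried through the induction so that the shifted sums leave no boundary
    terms. *)
Lemma havercos_pow_trig x0 m : exists c : Z -> C,
  (forall k, (Z.of_nat m < Z.abs k)%Z -> c k = RtoC 0) /\
  forall x, RtoC (havercos x0 x ^ m) = trig_poly m c x.
Proof.
  induction m as [|m [c [Hc IH]]].
  - exists (fun k => RtoC (if Z.eq_dec k 0 then 1 else 0)). split.
    + intros k Hk. destruct Z.eq_dec; auto. lia.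
    + intros x. rewrite trig_poly_zsum. cbn [zsumC]. rewrite echar_0. simpl. ring.
  - set (w := echar 1 x0).
    exists (fun k => Cplus (Cmult (RtoC (1/2)) (c k))
      (Cplus (Cmult (Cmult (RtoC (1/4)) (Cconj w)) (c (k - 1)%Z))
             (Cmult (Cmult (RtoC (1/4)) w) (c (k + 1)%Z)))). split.
    + intros k Hk. rewrite !Hc by lia. ring.
    + intros x. rewrite <- tech_pow_Rmult, RtoC_mult, IH, !trig_poly_zsum, havercos_echar. fold w.
      set (F := fun k => Cmult (c k) (echar k x)).
      assert (HF : forall k, (Z.of_nat m < Z.abs k)%Z -> F k = RtoC 0).
      { intros k Hk. unfold F. rewrite Hc by lia. ring. }
      rewrite (zsumC_ext _ (fun k => Cplus (Cmult (RtoC (1/2)) (F k))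
        (Cplus (Cmult (Cmult (Cmult (RtoC (1/4)) (Cconj w)) (echar 1 x)) (F (k - 1)%Z))
             (Cmult (Cmult (Cmult (RtoC (1/4)) w) (echar (-1) x)) (F (k + 1)%Z)))) (S m)).
      2:{ intros k _. unfold F.
          assert (E1 : Cmult (echar 1 x) (echar (k - 1) x) = echar k x)
            by (rewrite <- echar_add; f_equal; lia).
          assert (E2 : Cmult (echar (-1) x) (echar (k + 1) x) = echar k x)
            by (rewrite <- echar_add; f_equal; lia).
          transitivity (Cplus (Cmult (RtoC (1/2)) (Cmult (c k) (echar k x)))
            (Cplus (Cmult (Cmult (Cmult (RtoC (1/4)) (Cconj w)) (c (k - 1)%Z))
                          (Cmult (echar 1 x) (echar (k - 1) x)))
                   (Cmult (Cmult (Cmult (RtoC (1/4)) w) (c (k + 1)%Z))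
                          (Cmult (echar (-1) x) (echar (k + 1) x))))).
          rewrite E1, E2; ring.
          ring. }
      rewrite !zsumC_plus, !zsumC_scal, (zsumC_pred F), (zsumC_succ F).
      cbn [zsumC]. rewrite !(HF (Z.of_nat (S m))), !(HF (- Z.of_nat (S m))%Z),
        (HF (- Z.of_nat (S m) - 1)%Z), (HF (Z.of_nat (S m) + 1)%Z) by lia.
      ring.
Qed.

(** For a nonnegative function the [L^1] norm, which dominates all coefficients, is the integral
    itself. *)
Lemma fourier_RtoC_le (h : R -> R) k :
  (forall x, continuous h x) -> (forall x, 0 <= h x) ->
  Cmod (fourier (fun x => RtoC (h x)) k) <= RInt h 0 1.
Proof.
  intros Hc Hp. unfold fourier. apply Cmod_CInt_le; auto; try lra.
  - intros; ccont.
  - intros. rewrite Cmod_mult, Cmod_conj, Cmod_echar, Cmod_R, Rabs_pos_eq; auto; lra.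
Qed.

(* [havercos x0 ^ m] is a trigonometric polynomial whose coefficients are at most its
   integral. *)
Lemma Cmod_CInt_havercos_pow_le (g : R -> C) (T x0 : R) (m : nat) :
  (forall x, Ccont g x) ->
  (forall n, zsumR (fun k => Cmod (fourier g k)) n <= T) ->
  Cmod (CInt (fun x => Cmult (g x) (RtoC (havercos x0 x ^ m))) 0 1)
    <= RInt (fun x => havercos x0 x ^ m) 0 1 * T
  /\ 1 <= (2 * INR m + 1) * RInt (fun x => havercos x0 x ^ m) 0 1.
Proof.
  intros Hg HT. set (I := RInt (fun x => havercos x0 x ^ m) 0 1).
  destruct (havercos_pow_trig x0 m) as [c [_ Hc]].
  assert (Hck : forall k, (Z.abs k <= Z.of_nat m)%Z -> Cmod (c k) <= I).
  { intros k Hk.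
    replace (c k) with (fourier (fun x => RtoC (havercos x0 x ^ m)) k).
    - apply fourier_RtoC_le. apply continuous_havercos_pow.
      intros x; apply pow_le, havercos_bounds.
    - transitivity (fourier (trig_poly m c) k).
      + apply CInt_ext. intros x; now rewrite Hc.
      + rewrite fourier_trig_poly. now destruct Z_le_dec. }
  assert (HI : 0 <= I).
  { eapply Rle_trans; [apply Cmod_ge_0 | apply (Hck 0%Z); lia]. }
  split.
  - rewrite (CInt_ext _
      (fun x => zsumC (fun k => Cmult (c k) (Cmult (g x) (echar k x))) m)).
    2:{ intros x. rewrite Hc, trig_poly_zsum, <- zsumC_scal. apply zsumC_ext. intros; ring. }
    rewrite (CInt_zsum (fun k x => Cmult (c k) (Cmult (g x) (echar k x)))) by (intros; ccont).
    eapply Rle_trans; [apply Cmod_zsumC_le|].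
    (* Integrating [g] against [echar k], without conjugation, gives the coefficient of index
       [- k]. *)
    apply Rle_trans with (zsumR (fun k => I * Cmod (fourier g (- k))) m).
    + apply zsumR_le. intros k Hk.
      rewrite CInt_scal by (intros; ccont). rewrite Cmod_mult.
      apply Rmult_le_compat; auto using Cmod_ge_0.
      right. f_equal. unfold fourier. apply CInt_ext. intros x.
      now rewrite <- echar_opp, Z.opp_involutive.
    + rewrite zsumR_scal, (zsumR_opp (fun k => Cmod (fourier g k))).
      now apply Rmult_le_compat_l.
  (* The kernel has value 1 at [x0], which is at most the sum of the moduli of its [2m + 1]
     coefficients. *)
  - apply Rle_trans with (Cmod (trig_poly m c x0)).
    + rewrite <- Hc. unfold havercos. rewrite Rminus_diag, Rmult_0_r, cos_0.
      replace ((1 + 1) / 2) with 1 by field. rewrite pow1, Cmod_1. lra.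
    + rewrite trig_poly_zsum. eapply Rle_trans; [apply Cmod_zsumC_le|].
      rewrite <- zsumR_const. apply zsumR_le. intros k Hk.
      rewrite Cmod_mult, Cmod_echar, Rmult_1_r. auto.
Qed.

Lemma periodic_Z {T : Type} (f : R -> T) :
  (forall x, f (x + 1) = f x) -> forall (k : Z) x, f (x + IZR k) = f x.
Proof.
  intros H. assert (Hn : forall (n : nat) x, f (x + INR n) = f x).
  { induction n; intros x. f_equal; simpl; ring.
    rewrite S_INR, <- Rplus_assoc, H. auto. }
  intros k x. destruct (Z_le_gt_dec 0 k).
  - rewrite <- (Z2Nat.id k), <- INR_IZR_INZ by lia. auto.
  - rewrite <- (Hn (Z.to_nat (- k)) (x + IZR k)). f_equal.
    rewrite INR_IZR_INZ, Z2Nat.id, opp_IZR by lia. ring.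
Qed.

(** Modulo 1 every [x] has a representative [y] within 1/2 of [x0]. If [y] is close to [x0],
    continuity gives the first alternative; otherwise the second follows because cosine decreases on
    [0, pi]. *)
Lemma havercos_small_of_far (g : R -> C) (x0 eps : R) : cont_on_T g -> 0 < eps ->
  exists q, 0 <= q < 1 /\ forall x, Cmod (Cminus (g x) (g x0)) <= eps \/ havercos x0 x <= q.
Proof.
  intros [Hc Hp] He.
  (* A ball of the product structure on [C] is a square, where the modulus can exceed the radius by
     a factor up to [sqrt 2]; hence the radius [eps / sqrt 2]. *)
  destruct (proj1 (filterlim_locally (F := locally x0) g (g x0)) (Hc x0)
    (mkposreal _ (Rdiv_lt_0_compat _ _ He (Rlt_sqrt2_0)))) as [d Hd].
  set (d' := Rmin d (1/4)).
  assert (Hd' : 0 < d' <= 1/4 /\ d' <= d).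
  { unfold d'. generalize (cond_pos d) (Rmin_l d (1/4)) (Rmin_r d (1/4)).
    intros. split; [split|]; auto. apply Rmin_glb_lt; lra. }
  assert (HP := PI_RGT_0).
  exists ((1 + cos (2 * PI * d')) / 2). split.
  - generalize (COS_bound (2 * PI * d')); intros.
    assert (cos (2 * PI * d') < cos 0) by (apply cos_decreasing_1; nra).
    rewrite cos_0 in *. lra.
  - intros x.
    (* With this [j] the difference [y - x0] lies in [-1/2, 1/2). *)
    set (j := up (x - x0 - 1/2)).
    assert (Hj := archimed (x - x0 - 1/2)). fold j in Hj.
    set (y := x + IZR (- j)).
    assert (Ey : y = x - IZR j) by (unfold y; rewrite opp_IZR; ring).
    assert (Hgy : g y = g x) by now apply periodic_Z.
    assert (Hhy : havercos x0 y = havercos x0 x).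
    { apply (periodic_Z (havercos x0)). intros t. unfold havercos.
      generalize (f_equal fst (echar_period 1 (t - x0))). unfold echar; simpl.
      rewrite !Rmult_1_r. replace (t + 1 - x0) with (t - x0 + 1) by ring. intros ->. auto. }
    rewrite <- Hgy, <- Hhy.
    destruct (Rlt_le_dec (Rabs (y - x0)) d') as [H|H].
    + left.
      assert (B : ball x0 d y) by (change (Rabs (y - x0) < d); lra).
      specialize (Hd y B). apply C_NormedModule_mixin_compat2 in Hd.
      simpl in Hd. left. eapply Rlt_le_trans. exact Hd. right. field.
      generalize Rlt_sqrt2_0; lra.
    + right. unfold havercos. apply Rmult_le_compat_r; [lra|]. apply Rplus_le_compat_l.
      replace (cos (2 * PI * (y - x0))) with (cos (2 * PI * Rabs (y - x0))).
      * assert (Rabs (y - x0) <= 1/2) by (apply Rabs_le; lra).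
        set (r := Rabs (y - x0)) in *.
        assert (0 <= PI * d') by (apply Rmult_le_pos; lra).
        assert (0 <= PI * (1/2 - r)) by (apply Rmult_le_pos; lra).
        assert (0 <= PI * (r - d')) by (apply Rmult_le_pos; lra).
        apply cos_decr_1; lra.
      * unfold Rabs; destruct Rcase_abs; auto.
        rewrite Ropp_mult_distr_r_reverse. apply cos_neg.
Qed.

(** The factor [2m + 1] is the price of dividing by the integral of the kernel, which may be as
    small as [1 / (2m + 1)]. *)
Lemma lin_geom_small (q M eps : R) : 0 <= q < 1 -> 0 < eps -> 0 <= M ->
  exists m, M * q ^ m * (2 * INR m + 1) <= eps.
Proof.
  intros Hq He HM.
  destruct (Req_dec q 0) as [->|Hq0].
  { exists 1%nat. simpl. lra. }
  set (r := sqrt q).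
  assert (Hr : 0 < r) by (apply sqrt_lt_R0; lra).
  assert (Hr2 : r * r = q) by (apply sqrt_sqrt; lra).
  assert (Hr1 : r < 1) by nra.
  (* Bernoulli's inequality for 1/r bounds m r^m, and q^m = r^m r^m. *)
  set (u := / r - 1).
  assert (Hu : 0 < u).
  { unfold u. apply Rlt_0_minus. rewrite <- Rinv_1 at 1. apply Rinv_lt_contravar; lra. }
  assert (HB : forall m, (1 + INR m * u) * r ^ m <= 1).
  { intros m. generalize (poly m u Hu). unfold u at 2.
    replace (1 + (/ r - 1)) with (/ r) by ring. rewrite pow_inv. intros H.
    apply Rmult_le_reg_r with (/ r ^ m). apply Rinv_0_lt_compat, pow_lt; auto.
    rewrite Rmult_assoc, Rinv_r, Rmult_1_r, Rmult_1_l; auto. apply pow_nonzero. lra. }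
  (* The summand [2 / u] bounds [2 m r^m] by Bernoulli, and 1 bounds [r^m]. *)
  set (K := 2 / u + 1).
  assert (HK : 0 < K).
  { unfold K. assert (0 < 2 / u) by (apply Rdiv_lt_0_compat; lra). lra. }
  assert (Hm : forall m, r ^ m * (2 * INR m + 1) <= K).
  { intros m. specialize (HB m). unfold K.
    assert (0 < r ^ m) by now apply pow_lt.
    assert (Hm1 : r ^ m * INR m <= / u).
    { apply Rmult_le_reg_r with u; auto. rewrite Rinv_l by lra. nra. }
    assert (r ^ m <= 1).
    { assert (0 <= INR m * u * r ^ m); [|lra].
      apply Rmult_le_pos; [apply Rmult_le_pos; [apply pos_INR|]|]; lra. }
    unfold Rdiv. nra. }
  destruct (pow_lt_1_zero r) with (eps / (M * K + 1)) as [m Hm'].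
  { now rewrite Rabs_pos_eq by lra. }
  { apply Rdiv_lt_0_compat; nra. }
  exists m. specialize (Hm' m (Nat.le_refl m)). specialize (Hm m).
  rewrite Rabs_pos_eq in Hm' by (apply pow_le; lra).
  assert (0 < r ^ m) by now apply pow_lt.
  rewrite <- Hr2, Rpow_mult_distr.
  apply Rle_trans with (r ^ m * (M * K)).
  - replace (M * (r ^ m * r ^ m) * (2 * INR m + 1)) with
      (r ^ m * (M * (r ^ m * (2 * INR m + 1)))) by ring.
    apply Rmult_le_compat_l; [lra|]. now apply Rmult_le_compat_l.
  - apply Rle_trans with (r ^ m * (M * K + 1)); [nra|].
    apply Rlt_le in Hm'. apply Rmult_le_compat_r with (r := M * K + 1) in Hm'; [|nra].
    eapply Rle_trans; [exact Hm'|]. right. field. nra.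
Qed.

(** Let [J] be the integral of [g] against the kernel. Then [Cmod J <= T I], and [J] differs from
    [g x0 * I] by at most [e/2 I] from points where [g] is near [g x0] and [M q^m] from the others.
    For suitable [m] the latter is also at most [e/2 I], and division by [I] gives [T + e]. *)
Lemma Cmod_le_fourier_l1 (g : R -> C) (T : R) : cont_on_T g ->
  (forall n, zsumR (fun k => Cmod (fourier g k)) n <= T) ->
  forall x, Cmod (g x) <= T.
Proof.
  intros Hg HT x0. apply Rle_plus_epsilon. intros e He.
  assert (HT0 : 0 <= T).
  { eapply Rle_trans; [|apply (HT O)]. apply Cmod_ge_0. }
  destruct (havercos_small_of_far g x0 (e / 2)) as [q [Hq Hx]]; auto; try lra.
  destruct Hg as [Hc Hp].
  destruct (continuous_bounded (fun x => Cminus (g x) (g x0)) 0 1) as [M HM].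
  { intros; ccont. }
  rewrite Rmin_left, Rmax_right in HM by lra.
  assert (HM0 : 0 <= M).
  { eapply Rle_trans; [apply Cmod_ge_0 | apply (HM 0); lra]. }
  destruct (lin_geom_small q M (e / 2) Hq) as [m Hm]; auto; try lra.
  destruct (Cmod_CInt_havercos_pow_le g T x0 m Hc HT) as [H1 H2].
  set (I := RInt (fun x => havercos x0 x ^ m) 0 1) in *.
  set (J := CInt (fun x => Cmult (g x) (RtoC (havercos x0 x ^ m))) 0 1) in *.
  assert (Hhc := continuous_havercos_pow x0 m).
  assert (Hi : 0 <= 2 * INR m + 1) by (generalize (pos_INR m); lra).
  assert (HI : 0 < I) by nra.
  assert (HJ : Cmod (Cminus J (Cmult (g x0) (RtoC I))) <= e / 2 * I + M * q ^ m).
  { unfold J, I. rewrite <- CInt_RtoC by (intros; apply Hhc).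
    rewrite <- CInt_scal, <- CInt_minus by (intros; ccont).
    rewrite (CInt_ext _ (fun x => Cmult (Cminus (g x) (g x0)) (RtoC (havercos x0 x ^ m))))
      by (intros; ring).
    apply Rle_trans with (RInt (fun t => e / 2 * havercos x0 t ^ m + M * q ^ m * 1) 0 1).
    - apply Cmod_CInt_le; [lra| intros; ccont | intros; rcont |].
      intros x Hx01. assert (Hb := havercos_bounds x0 x).
      assert (Hpw : 0 <= havercos x0 x ^ m) by now apply pow_le.
      assert (Hqm : 0 <= q ^ m) by now apply pow_le.
      rewrite Cmod_mult, Cmod_R, Rabs_pos_eq by auto.
      destruct (Hx x) as [Hx'|Hx'].
      + assert (0 <= M * q ^ m) by now apply Rmult_le_pos. nra.
      + assert (havercos x0 x ^ m <= q ^ m) by (apply pow_incr; lra).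
        assert (Cmod (Cminus (g x) (g x0)) * havercos x0 x ^ m <= M * q ^ m)
          by (apply Rmult_le_compat; auto using Cmod_ge_0).
        nra.
    - rewrite (RInt_lin2 (fun t => havercos x0 t ^ m) (fun _ => 1)) by (intros; rcont).
      right. rewrite RInt_const. unfold scal; simpl; unfold mult; simpl. ring. }
  assert (Hfin : Cmod (g x0) * I <= (T + e) * I).
  { apply Rle_trans with (Cmod J + Cmod (Cminus J (Cmult (g x0) (RtoC I)))).
    - replace (Cmod (g x0) * I) with (Cmod (Cmult (g x0) (RtoC I)))
        by (rewrite Cmod_mult, Cmod_R, Rabs_pos_eq by lra; ring).
      replace (Cmult (g x0) (RtoC I)) with
        (Cplus J (Copp (Cminus J (Cmult (g x0) (RtoC I))))) at 1 by ring.
      eapply Rle_trans; [apply Cmod_triangle|]. rewrite Cmod_opp. lra.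
    (* Here [1 <= (2m + 1) I] turns the absolute bound on [M q^m] into one relative to [I]. *)
    - assert (M * q ^ m <= e / 2 * I).
      { assert (0 <= M * q ^ m) by (apply Rmult_le_pos; auto; apply pow_le; lra).
        apply Rle_trans with (M * q ^ m * ((2 * INR m + 1) * I)); nra. }
      nra. }
  now apply Rmult_le_reg_r in Hfin.
Qed.

(** * Least squares *)

Lemma rsum_le F G m : (forall j, (j < m)%nat -> F j <= G j) -> rsum F m <= rsum G m.
Proof.
  induction m; intros H; simpl; [lra|]. apply Rplus_le_compat; auto.
Qed.

Lemma rsum_ext F G m : (forall j, (j < m)%nat -> F j = G j) -> rsum F m = rsum G m.
Proof. induction m; intros H; simpl; auto. rewrite IHm, H; auto. Qed.

Lemma rsum_plus F G m : rsum (fun j => F j + G j) m = rsum F m + rsum G m.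
Proof. induction m; simpl; [ring|]. rewrite IHm; ring. Qed.

Lemma rsum_scal c F m : rsum (fun j => c * F j) m = c * rsum F m.
Proof. induction m; simpl; [ring|]. rewrite IHm; ring. Qed.

Lemma rsum_ge_0 F m : (forall j, (j < m)%nat -> 0 <= F j) -> 0 <= rsum F m.
Proof. induction m; intros H; simpl; [lra|]. apply Rplus_le_le_0_compat; auto. Qed.

(** The sum over [n < |k| <= n + N], in pairs [k], [- k]. Infinite tails enter only through bounds
    uniform in [N]. *)
Definition tail_sum (F : Z -> R) (n N : nat) : R :=
  rsum (fun j => F (Z.of_nat (S (n + j))) + F (- Z.of_nat (S (n + j)))%Z) N.

Lemma tail_sum_le F G n N : (forall k, (Z.of_nat n < Z.abs k)%Z -> F k <= G k) ->
  tail_sum F n N <= tail_sum G n N.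
Proof.
  intros H. apply rsum_le. intros j _. apply Rplus_le_compat; apply H; lia.
Qed.

Lemma zsumR_tail F n N : (forall k, (Z.abs k <= Z.of_nat n)%Z -> F k = 0) ->
  zsumR F (n + N) = tail_sum F n N.
Proof.
  intros H. induction N.
  - rewrite Nat.add_0_r. unfold tail_sum; simpl. revert H. induction n; intros H; cbn [zsumR].
    apply H; lia. rewrite !H by lia. rewrite IHn. lra. intros; apply H; lia.
  - rewrite Nat.add_succ_r. cbn [zsumR]. rewrite IHN. reflexivity.
Qed.

Lemma trig_poly_minus n c d x :
  trig_poly n (fun k => Cminus (c k) (d k)) x = Cminus (trig_poly n c x) (trig_poly n d x).
Proof.
  rewrite !trig_poly_zsum, <- zsumC_minus. apply zsumC_ext; intros; ring.
Qed.

Lemma trig_poly_scal n a c x :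
  trig_poly n (fun k => Cmult a (c k)) x = Cmult a (trig_poly n c x).
Proof.
  rewrite !trig_poly_zsum, <- zsumC_scal. apply zsumC_ext; intros; ring.
Qed.

Lemma in_Tn_minus n p q : in_Tn n p -> in_Tn n q -> in_Tn n (fun x => Cminus (p x) (q x)).
Proof.
  intros [c Hc] [d Hd]. exists (fun k => Cminus (c k) (d k)). intros x.
  now rewrite trig_poly_minus, Hc, Hd.
Qed.

Lemma in_Tn_scal n a p : in_Tn n p -> in_Tn n (fun x => Cmult a (p x)).
Proof.
  intros [c Hc]. exists (fun k => Cmult a (c k)). intros x. now rewrite trig_poly_scal, Hc.
Qed.

Lemma in_Tn_const n a : in_Tn n (fun _ => a).
Proof.
  exists (fun k => if Z.eq_dec k 0 then a else RtoC 0). intros x. rewrite trig_poly_zsum.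
  induction n; cbn [zsumC].
  - rewrite echar_0. simpl. ring.
  - rewrite <- IHn. destruct Z.eq_dec; [lia|]. destruct Z.eq_dec; [lia|]. ring.
Qed.

Lemma Ccont_in_Tn n p : in_Tn n p -> forall x, Ccont p x.
Proof.
  intros [c Hc] x. apply Ccont_ext with (trig_poly n c). auto. apply Ccont_trig_poly.
Qed.

Lemma trig_poly_period n c x : trig_poly n c (x + 1) = trig_poly n c x.
Proof.
  rewrite !trig_poly_zsum. apply zsumC_ext. intros. now rewrite echar_period.
Qed.

Lemma Cmod2_plus (z w : C) :
  Cmod (Cplus z w) ^ 2 = Cmod z ^ 2 + Cmod w ^ 2 + 2 * fst (Cmult z (Cconj w)).
Proof. rewrite !Cmod2. simpl. ring. Qed.

Lemma L2sq_le_sup g T : (forall x, Ccont g x) -> (forall x, Cmod (g x) <= T) -> L2sq g <= T ^ 2.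
Proof.
  intros Hc H. unfold L2sq.
  apply Rle_trans with (RInt (fun _ => T ^ 2) 0 1).
  - apply RInt_le; [lra| | |].
    + apply (ex_RInt_continuous (V := R_CompleteNormedModule)). intros; now apply continuous_Cmod2.
    + apply ex_RInt_const.
    + intros x _. apply pow_incr. split; auto. apply Cmod_ge_0.
  - rewrite RInt_const. unfold scal; simpl; unfold mult; simpl. lra.
Qed.

Lemma L2sq_const_1 : L2sq (fun _ => RtoC 1) = 1.
Proof.
  unfold L2sq. rewrite RInt_const, Cmod_1. unfold scal; simpl; unfold mult; simpl. lra.
Qed.

Lemma orthogonal_Tn g h n : (forall x, Ccont g x) ->
  (forall k, (Z.abs k <= Z.of_nat n)%Z -> fourier g k = RtoC 0) -> in_Tn n h ->
  CInt (fun x => Cmult (g x) (Cconj (h x))) 0 1 = RtoC 0.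
Proof.
  intros Hg H0 [d Hd].
  rewrite (CInt_ext _ (fun x => zsumC (fun k =>
     Cmult (Cconj (d k)) (Cmult (g x) (Cconj (echar k x)))) n)).
  2:{ intros x. rewrite Hd, trig_poly_zsum.
      clear. induction n; cbn [zsumC]; rewrite ?Cplus_conj, ?Cmult_conj. ring.
      rewrite <- IHn. ring. }
  rewrite (CInt_zsum (fun k x => Cmult (Cconj (d k)) (Cmult (g x) (Cconj (echar k x)))))
    by (intros; ccont).
  rewrite (zsumC_ext _ (fun _ => Cmult (RtoC 0) (RtoC 0))).
  2:{ intros k Hk. rewrite CInt_scal by (intros; ccont).
      change (Cmult (Cconj (d k)) (fourier g k) = Cmult (RtoC 0) (RtoC 0)).
      rewrite H0 by auto. ring. }
  rewrite (zsumC_scal (RtoC 0) (fun _ => RtoC 0)). apply Cmult_0_l.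
Qed.

Lemma pythagoras g h n : (forall x, Ccont g x) ->
  (forall k, (Z.abs k <= Z.of_nat n)%Z -> fourier g k = RtoC 0) -> in_Tn n h ->
  L2sq (fun x => Cplus (g x) (h x)) = L2sq g + L2sq h.
Proof.
  intros Hg H0 Hh. assert (Hhc := Ccont_in_Tn n h Hh).
  assert (HO := orthogonal_Tn g h n Hg H0 Hh).
  assert (Hgh : forall x, Ccont (fun x => Cmult (g x) (Cconj (h x))) x) by (intros; ccont).
  rewrite CInt_eq in HO by auto. apply (f_equal fst) in HO.
  simpl fst in HO at 1. simpl in HO.
  assert (H1 := fun x => continuous_Cmod2 g x (Hg x)).
  assert (H2 := fun x => continuous_Cmod2 h x (Hhc x)).
  assert (H3 := fun x => Ccont_fst _ x (Hgh x)).
  unfold L2sq.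
  (* The coefficients 1 bring the integrand into the shape of [RInt_lin2]; the integral of the last
     term vanishes by orthogonality. *)
  rewrite (RInt_ext_R _ (fun x => 1 * (1 * Cmod (g x) ^ 2 + 1 * Cmod (h x) ^ 2)
     + 2 * fst (Cmult (g x) (Cconj (h x))))).
  2:{ intros. rewrite Cmod2_plus. ring. }
  rewrite (RInt_lin2 (fun x => 1 * Cmod (g x) ^ 2 + 1 * Cmod (h x) ^ 2)
     (fun x => fst (Cmult (g x) (Cconj (h x))))).
  rewrite (RInt_lin2 (fun x => Cmod (g x) ^ 2) (fun x => Cmod (h x) ^ 2)).
  simpl. rewrite HO. eqR. ring.
  all: auto. intros; rcont.
Qed.

Lemma wsum_minus_scal L X tau n (u h : R -> C) (t : R) :
  wsum L X tau n (fun x => Cminus (u x) (Cmult (RtoC t) (h x))) =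
  wsum L X tau n u
  - t * rsum (fun k => 2 * fst (Cmult (u (X n k)) (Cconj (h (X n k)))) * tau n k) (L n)
  + t ^ 2 * wsum L X tau n h.
Proof.
  unfold wsum. unfold Rminus.
  rewrite Ropp_mult_distr_l, <- !rsum_scal, <- !rsum_plus.
  apply rsum_ext. intros j _. rewrite !Cmod2. simpl. ring.
Qed.

(* The variational inequality for the minimiser, tested with [p + t h] for small [t > 0]. *)
Lemma LS_projection L X tau f n p q :
  (forall k, (k < L n)%nat -> 0 < tau n k) ->
  LS_solution L X tau f n p -> in_Tn n q ->
  wsum L X tau n (fun x => Cminus (q x) (p x)) <= wsum L X tau n (fun x => Cminus (f x) (q x)).
Proof.
  intros Htau [Hp Hmin] Hq.
  set (h := fun x => Cminus (q x) (p x)). set (u := fun x => Cminus (f x) (p x)).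
  assert (Hh : in_Tn n h) by now apply in_Tn_minus.
  assert (E : forall t, wsum L X tau n u <=
     wsum L X tau n (fun x => Cminus (u x) (Cmult (RtoC t) (h x)))).
  { intros t. unfold u.
    eapply Rle_trans; [apply (Hmin (fun x => Cminus (p x) (Cmult (RtoC (- t)) (h x))))|].
    - apply in_Tn_minus; auto. now apply in_Tn_scal.
    - right. apply rsum_ext. intros j _. f_equal. f_equal. f_equal.
      rewrite RtoC_opp. ring. }
  (* Since [f - q = (f - p) - (q - p)], this is the value at [t = 1] of the same quadratic, namely
     [U - S + W]. It is at least [W] once [U >= 0] and [S <= 0]. *)
  assert (E1 : wsum L X tau n (fun x => Cminus (f x) (q x)) =
     wsum L X tau n (fun x => Cminus (u x) (Cmult (RtoC 1) (h x)))).
  { apply rsum_ext. intros j _. f_equal. f_equal. f_equal. unfold u, h. ring. }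
  rewrite E1, wsum_minus_scal.
  set (S := rsum _ (L n)). set (W := wsum L X tau n h) in *.
  set (U := wsum L X tau n u) in *.
  assert (E2 : forall t, 0 <= - t * S + t ^ 2 * W).
  { intros t. specialize (E t). rewrite wsum_minus_scal in E. fold S U W in E. lra. }
  assert (HU : 0 <= U).
  { apply rsum_ge_0. intros j Hj. apply Rmult_le_pos; [apply pow2_ge_0|].
    now apply Rlt_le, Htau. }
  assert (S <= 0).
  { destruct (Rle_lt_dec S 0) as [|HS]; auto. exfalso.
    destruct (Rle_lt_dec W 0).
    - specialize (E2 1). lra.
    (* The minimiser of [- t S + t^2 W], where the value is [- S^2 / (4 W)]. *)
    - specialize (E2 (S / (2 * W))).
      replace (- (S / (2 * W)) * S + (S / (2 * W)) ^ 2 * W) with (- (S * S / (4 * W))) in E2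
        by (field; lra).
      assert (0 < S * S / (4 * W)) by (apply Rdiv_lt_0_compat; nra). lra. }
  lra.
Qed.

(** The constant 1, tested in degree 1, places the total weight between [A] and [B]. *)
Lemma MZ_family_le L X tau A B : MZ_family L X tau A B -> A <= B.
Proof.
  intros (HA & HB & _ & H).
  destruct (H 1%nat (Nat.le_refl 1) _ (in_Tn_const 1 (RtoC 1))) as [H1 H2].
  rewrite L2sq_const_1 in *. lra.
Qed.

(** Common core of (i) and (ii). The number [T] bounds [f - q] in sup norm, which controls its [L^2]
    norm and its sampled values at once. *)
Lemma error_le_tail L X tau A B f n p T :
  MZ_family L X tau A B -> cont_on_T f -> (1 <= n)%nat -> LS_solution L X tau f n p ->
  (forall N, tail_sum (fun k => Cmod (fourier f k)) n N <= T) ->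
  L2norm (fun x => Cminus (f x) (p x)) <= T * sqrt (1 + (B / A) ^ 2).
Proof.
  intros HMZ [Hfc Hfp] Hn HLS HT.
  assert (HAB := MZ_family_le _ _ _ _ _ HMZ).
  destruct HMZ as (HA & HB & HX & HMZ).
  (* For [N = 0] the tail is empty. *)
  assert (HT0 : 0 <= T) by exact (HT O).
  set (q := trig_poly n (fourier f)).
  assert (Hq : in_Tn n q) by (exists (fourier f); auto).
  assert (Hqc := Ccont_in_Tn n q Hq).
  set (g := fun x => Cminus (f x) (q x)).
  assert (Hgc : forall x, Ccont g x) by (intros x; unfold g; ccont).
  assert (Hgk : forall k, fourier g k =
     if Z_le_dec (Z.abs k) (Z.of_nat n) then RtoC 0 else fourier f k).
  { intros k. unfold g. rewrite fourier_minus by auto. unfold q.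
    rewrite fourier_trig_poly. destruct Z_le_dec; ring. }
  assert (Hg0 : forall k, (Z.abs k <= Z.of_nat n)%Z -> fourier g k = RtoC 0).
  { intros k Hk. rewrite Hgk. now destruct Z_le_dec. }
  assert (HgT : forall x, Cmod (g x) <= T).
  { apply Cmod_le_fourier_l1.
    - split; auto. intros x. unfold g, q. now rewrite Hfp, trig_poly_period.
    - intros m. destruct (Nat.le_gt_cases m n) as [Hm|Hm].
      + eapply Rle_trans; [|apply HT0].
        apply Rle_trans with (zsumR (fun _ => 0) m); [|rewrite zsumR_const; lra].
        apply zsumR_le. intros k Hk. rewrite Hg0, Cmod_0 by lia. lra.
      + replace m with (n + (m - n))%nat by lia. rewrite zsumR_tail.
        * eapply Rle_trans; [|apply (HT (m - n)%nat)].
          apply tail_sum_le. intros k Hk. rewrite Hgk. destruct Z_le_dec; [lia|]. lra.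
        * intros k Hk. now rewrite Hg0, Cmod_0. }
  set (h := fun x => Cminus (q x) (p x)).
  assert (Hh : in_Tn n h) by (apply in_Tn_minus; auto; apply HLS).
  assert (E : L2sq (fun x => Cminus (f x) (p x)) = L2sq g + L2sq h).
  { rewrite <- (pythagoras g h n) by auto. apply RInt_ext_R. intros x.
    f_equal. f_equal. unfold g, h. ring. }
  (* The upper inequality for the constant 1 bounds the sum of the weights by [B]. *)
  assert (H1 : wsum L X tau n g <= T ^ 2 * B).
  { apply Rle_trans with (T ^ 2 * wsum L X tau n (fun _ => RtoC 1)).
    - unfold wsum. rewrite <- rsum_scal. apply rsum_le. intros j Hj.
      destruct (HX n j Hn Hj) as [_ Htau].
      rewrite Cmod_1, pow1, Rmult_1_l. apply Rmult_le_compat_r; [lra|].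
      apply pow_incr. split; auto. apply Cmod_ge_0.
    - apply Rmult_le_compat_l; [apply pow2_ge_0|].
      destruct (HMZ n Hn _ (in_Tn_const n (RtoC 1))) as [_ H]. rewrite L2sq_const_1 in H. lra. }
  assert (H2 := LS_projection L X tau f n p q (fun k Hk => proj2 (HX n k Hn Hk)) HLS Hq). fold g h in H2.
  destruct (HMZ n Hn h Hh) as [H3 _].
  assert (H4 : L2sq h <= T ^ 2 * (B / A)).
  { apply Rmult_le_reg_l with A; auto.
    replace (A * (T ^ 2 * (B / A))) with (T ^ 2 * B) by (field; lra). lra. }
  assert (H5 := L2sq_le_sup g T Hgc HgT).
  (* This allows [1 + B / A], which the argument yields, to be replaced by [1 + (B / A)^2]. *)
  assert (Hk : 1 <= B / A).
  { apply Rmult_le_reg_r with A; auto. unfold Rdiv. rewrite Rmult_assoc, Rinv_l; lra. }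
  unfold L2norm. rewrite E.
  rewrite <- (sqrt_pow2 T) by auto.
  rewrite <- sqrt_mult_alt by apply pow2_ge_0.
  apply sqrt_le_1_alt.
  assert (0 <= T ^ 2 * (B / A - 1) * (B / A)).
  { apply Rmult_le_pos; [apply Rmult_le_pos; [apply pow2_ge_0|]|]; lra. }
  lra.
Qed.

(** * Sobolev tails *)

(** The hypothesis [x^2 <= s w] avoids square roots. The induction step needs
    [2 c x_m <= a w_m + s_m b], which follows on squaring from
    [4 (a w_m) (s_m b) <= (a w_m + s_m b)^2]. *)
Lemma rsum_Cauchy_Schwarz (x s w : nat -> R) m :
  (forall j, 0 <= x j) -> (forall j, 0 <= s j) -> (forall j, 0 <= w j) ->
  (forall j, x j ^ 2 <= s j * w j) ->
  rsum x m ^ 2 <= rsum s m * rsum w m.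
Proof.
  intros Hx Hs Hw H. induction m as [|m IH]; cbn [rsum]; [lra|].
  assert (X := rsum_ge_0 x m (fun j _ => Hx j)).
  assert (S := rsum_ge_0 s m (fun j _ => Hs j)).
  assert (W := rsum_ge_0 w m (fun j _ => Hw j)).
  specialize (Hx m); specialize (Hs m); specialize (Hw m); specialize (H m).
  set (a := rsum s m) in *. set (b := rsum w m) in *. set (c := rsum x m) in *.
  assert (H2 : 2 * (c * x m) <= a * w m + s m * b).
  { apply Rsqr_incr_0; [|nra|nra]. unfold Rsqr.
    assert (c ^ 2 * x m ^ 2 <= (a * b) * (s m * w m)) by (apply Rmult_le_compat; auto using pow2_ge_0).
    generalize (pow2_ge_0 (a * w m - s m * b)). nra. }
  nra.
Qed.

(** A discrete form of the derivative of [k^(-s)], which lets sums of powers telescope as in the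
    integral test. It follows from [ln (k - 1) <= ln k - 1/k] and [1 + x <= exp x]. *)
Lemma Rpower_opp_diff_ge (s k : R) : 0 < s -> 1 < k ->
  s * Rpower k (- s - 1) <= Rpower (k - 1) (- s) - Rpower k (- s).
Proof.
  intros Hs Hk.
  assert (E : Rpower k (- s - 1) = Rpower k (- s) / k).
  { unfold Rminus. rewrite Rpower_plus, (Rpower_Ropp k 1), Rpower_1 by lra. reflexivity. }
  rewrite E. clear E.
  assert (Hl : ln (k - 1) <= ln k - / k).
  { replace (k - 1) with (k * (1 - / k)) by (field; lra).
    assert (0 < 1 - / k).
    { rewrite <- Rinv_1 at 1. apply Rlt_0_minus, Rinv_lt_contravar; lra. }
    rewrite ln_mult by lra.
    assert (ln (1 - / k) <= - / k); [|lra].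
    rewrite <- (ln_exp (- / k)). apply ln_le; auto.
    generalize (exp_ineq1_le (- / k)). lra. }
  assert (Hi : 0 < / k) by (apply Rinv_0_lt_compat; lra).
  assert (H1 : Rpower k (- s) * (1 + s * / k) <= Rpower (k - 1) (- s)).
  { apply Rle_trans with (Rpower k (- s) * exp (s * / k)).
    - apply Rmult_le_compat_l; [apply Rlt_le, exp_pos|]. apply exp_ineq1_le.
    - unfold Rpower. rewrite <- exp_plus.
      destruct (Req_dec (- s * ln k + s * / k) (- s * ln (k - 1))) as [->|Hne]; [lra|].
      apply Rlt_le, exp_increasing. nra. }
  unfold Rdiv. lra.
Qed.

Lemma Rpower_1_sq_le (sigma k : R) : 0 < sigma -> 0 < k ->
  Rpower (1 + k ^ 2) (- sigma) <= Rpower k (- (2 * sigma)).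
Proof.
  intros Hs Hk. unfold Rpower.
  assert (H : 2 * ln k <= ln (1 + k ^ 2)).
  { replace (2 * ln k) with (ln (k ^ 2)).
    apply ln_le; nra. rewrite <- Rpower_pow by auto. unfold Rpower. rewrite ln_exp. simpl. ring. }
  destruct (Req_dec (- sigma * ln (1 + k ^ 2)) (- (2 * sigma) * ln k)) as [->|Hne]; [lra|].
  apply Rlt_le, exp_increasing. nra.
Qed.

(** Origin of the constant: a weight is at most [2 k^(-2 sigma)], hence at most [2 / (2 sigma - 1)]
    times a difference of consecutive values of [k^(1 - 2 sigma)]. The factor equals
    [1 / (sigma - 1/2)], the square of [C_sigma]. *)
Lemma sob_weight_tail_le (sigma : R) (n N : nat) : 1 / 2 < sigma -> (1 <= n)%nat ->
  rsum (fun j => 2 * Rpower (1 + INR (S (n + j)) ^ 2) (- sigma)) N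
  <= / (sigma - 1/2) * Rpower (INR n) (1 - 2 * sigma).
Proof.
  intros Hs Hn.
  set (P := fun k => Rpower (INR k) (1 - 2 * sigma)).
  apply Rle_trans with (/ (sigma - 1/2) * (P n - P (n + N)%nat)).
  - induction N as [|N IH]; cbn [rsum].
    + rewrite Nat.add_0_r. lra.
    + set (k := INR (S (n + N))) in *.
      assert (Hk : 1 < k).
      { unfold k. apply lt_1_INR. lia. }
      assert (E1 := Rpower_1_sq_le sigma k ltac:(lra) ltac:(lra)).
      assert (E2 := Rpower_opp_diff_ge (2 * sigma - 1) k ltac:(lra) Hk).
      replace (- (2 * sigma - 1)) with (1 - 2 * sigma) in E2 by ring.
      replace (1 - 2 * sigma - 1) with (- (2 * sigma)) in E2 by ring.
      replace (k - 1) with (INR (n + N)) in E2 by (unfold k; rewrite S_INR; ring).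
      assert (E3 : P (n + S N)%nat = Rpower k (1 - 2 * sigma)).
      { unfold P, k. f_equal. f_equal. lia. }
      fold (P (n + N)%nat) in E2. rewrite <- E3 in E2.
      apply Rle_trans with (/ (sigma - 1/2) * (P n - P (n + N)%nat)
         + / (sigma - 1/2) * (P (n + N)%nat - P (n + S N)%nat)); [|right; ring].
      apply Rplus_le_compat; auto.
      apply Rmult_le_reg_l with (sigma - 1/2); [lra|].
      replace ((sigma - 1 / 2) * (/ (sigma - 1 / 2) * (P (n + N)%nat - P (n + S N)%nat)))
        with (P (n + N)%nat - P (n + S N)%nat) by (field; lra).
      apply Rmult_le_compat_l with (r := 2 * sigma - 1) in E1; [|lra]. fold k. lra.
  - apply Rmult_le_compat_l. apply Rlt_le, Rinv_0_lt_compat; lra.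
    assert (0 < P (n + N)%nat) by apply exp_pos. change (Rpower (INR n) (1 - 2 * sigma)) with (P n). lra.
Qed.

Lemma sob_term_ge_0 sigma f m : 0 <= sob_term sigma f m.
Proof.
  destruct m; simpl sob_term; [apply pow2_ge_0|].
  apply Rmult_le_pos; [|apply Rlt_le, exp_pos].
  apply Rplus_le_le_0_compat; apply pow2_ge_0.
Qed.

Lemma sob_tail_le_Series sigma f n N : in_Hsigma sigma f ->
  rsum (fun j => sob_term sigma f (S (n + j))) N <= Series (sob_term sigma f).
Proof.
  intros H. apply Rle_trans with (sum_n (sob_term sigma f) (n + N)).
  - induction N; cbn [rsum].
    + rewrite Nat.add_0_r. induction n. rewrite sum_O. apply sob_term_ge_0.
      rewrite sum_Sn. apply Rplus_le_le_0_compat; auto. apply sob_term_ge_0.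
    + rewrite Nat.add_succ_r, sum_Sn. apply Rplus_le_compat; auto. lra.
  - apply (is_lim_seq_incr_compare (sum_n (sob_term sigma f))).
    + now apply Series_correct.
    + intros k. rewrite sum_Sn. generalize (sob_term_ge_0 sigma f (S k)).
      unfold plus; simpl. lra.
Qed.

Lemma sob_tail_sum_le sigma f n N : 1 / 2 < sigma -> (1 <= n)%nat -> in_Hsigma sigma f ->
  tail_sum (fun k => Cmod (fourier f k)) n N
  <= / sqrt (sigma - 1/2) * Hnorm sigma f * Rpower (INR n) (- sigma + 1/2).
Proof.
  intros Hs Hn Hf.
  assert (Hsq : 0 < sqrt (sigma - 1/2)) by (apply sqrt_lt_R0; lra).
  (* The factor 2 pays for [(a + b)^2 <= 2 (a^2 + b^2)], as the coefficients of [k] and [- k] are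
     taken together. *)
  set (w := fun j => 2 * Rpower (1 + INR (S (n + j)) ^ 2) (- sigma)).
  set (s := fun j => sob_term sigma f (S (n + j))).
  assert (Hw : forall j, 0 <= w j).
  { intros j. apply Rmult_le_pos; [lra|]. apply Rlt_le, exp_pos. }
  assert (Hsp : forall j, 0 <= s j) by (intros; apply sob_term_ge_0).
  apply Rsqr_incr_0.
  2: { apply rsum_ge_0. intros. apply Rplus_le_le_0_compat; apply Cmod_ge_0. }
  2: { apply Rmult_le_pos; [|apply Rlt_le, exp_pos]. apply Rmult_le_pos; [|apply sqrt_pos].
       now apply Rlt_le, Rinv_0_lt_compat. }
  rewrite !Rsqr_pow2.
  apply Rle_trans with (rsum s N * rsum w N).
  - apply rsum_Cauchy_Schwarz; auto.
    + intros. apply Rplus_le_le_0_compat; apply Cmod_ge_0.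
    + intros j. unfold s, w. cbn [sob_term].
      set (k := S (n + j)). set (a := Cmod _). set (b := Cmod _).
      set (R1 := Rpower _ sigma). set (R2 := Rpower _ (- sigma)).
      assert (HR : R1 * R2 = 1).
      { unfold R1, R2. rewrite Rpower_Ropp, Rinv_r; auto. apply Rgt_not_eq, exp_pos. }
      replace ((a ^ 2 + b ^ 2) * R1 * (2 * R2)) with (2 * (a ^ 2 + b ^ 2) * (R1 * R2)) by ring.
      rewrite HR. generalize (pow2_ge_0 (a - b)). nra.
  - assert (Hser : 0 <= Series (sob_term sigma f)).
    { apply (sob_tail_le_Series sigma f n 0 Hf). }
    apply Rle_trans with (Series (sob_term sigma f) *
      (/ (sigma - 1/2) * Rpower (INR n) (1 - 2 * sigma))).
    + apply Rmult_le_compat. now apply rsum_ge_0. now apply rsum_ge_0.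
      now apply sob_tail_le_Series. now apply sob_weight_tail_le.
    + right. unfold Hnorm. rewrite !Rpow_mult_distr, pow_inv, !pow2_sqrt by lra.
      rewrite <- (Rpower_pow 2 (Rpower _ _)) by apply exp_pos. rewrite Rpower_mult.
      replace ((- sigma + 1 / 2) * INR 2) with (1 - 2 * sigma) by (simpl; field). ring.
Qed.

(** * Complex differentiability *)

(** Here [C] is a module over itself as an absolute ring, the structure of the product rule. The
    derivatives in [analytic_strip] use [C_NormedModule] and are converted in [fourier_decay]. *)
Notation Cder G z l :=
  (is_derive (K := C_AbsRing) (V := AbsRing_NormedModule C_AbsRing) G z l).
Notation Cdiff G z :=
  (ex_derive (K := C_AbsRing) (V := AbsRing_NormedModule C_AbsRing) G z).

(** Filters and domination are unfolded once here; the later estimates work with increments [h]. *)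
Lemma Cder_iff (G : C -> C) (z l : C) :
  Cder G z l <->
  forall eps, 0 < eps -> exists d, 0 < d /\ forall h, Cmod h < d ->
    Cmod (Cminus (Cminus (G (Cplus z h)) (G z)) (Cmult l h)) <= eps * Cmod h.
Proof.
  split.
  - intros [_ H] eps He.
    destruct (H z (fun P HP => HP) (mkposreal eps He)) as [d Hd].
    exists d. split; [apply cond_pos|]. intros h Hh.
    assert (B : ball (M := AbsRing_UniformSpace C_AbsRing) z d (Cplus z h)).
    { unfold ball; simpl; unfold AbsRing_ball, abs, minus, plus, opp; simpl.
      replace (Cplus (Cplus z h) (Copp z)) with h by ring. exact Hh. }
    specialize (Hd _ B).
    unfold norm, minus, plus, opp, scal in Hd; simpl in Hd.
    unfold abs, mult in Hd; simpl in Hd.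
    replace (Cplus (Cplus z h) (Copp z)) with h in Hd by ring.
    rewrite (Cmult_comm l h). exact Hd.
  - intros H. split. apply is_linear_scal_l.
    intros x Hx. apply (is_filter_lim_locally_unique (V := AbsRing_NormedModule C_AbsRing)) in Hx.
    subst x. intros eps. destruct (H eps (cond_pos eps)) as [d [Hd0 Hd]].
    exists (mkposreal d Hd0). intros y Hy.
    unfold ball in Hy; simpl in Hy; unfold AbsRing_ball, abs, minus, plus, opp in Hy; simpl in Hy.
    specialize (Hd _ Hy).
    assert (E : forall u v : C, Cplus u (Cplus v (Copp u)) = v) by (intros; ring).
    rewrite E in Hd.
    unfold norm, minus, plus, opp, scal; simpl. unfold abs, mult; simpl.
    rewrite (Cmult_comm l) in Hd. exact Hd.
Qed.

Lemma Cdiff_mult F G z : Cdiff F z -> Cdiff G z -> Cdiff (fun w => Cmult (F w) (G w)) z.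
Proof.
  intros [a Ha] [b Hb]. eexists. apply (is_derive_mult (K := C_AbsRing) F G z a b Ha Hb).
  apply Cmult_comm.
Qed.

Lemma Cdiff_comp F G z : Cdiff F (G z) -> Cdiff G z -> Cdiff (fun w => F (G w)) z.
Proof. intros; now apply ex_derive_comp. Qed.

Lemma Cdiff_minus F G z : Cdiff F z -> Cdiff G z -> Cdiff (fun w => Cminus (F w) (G w)) z.
Proof. intros H1 H2. exact (ex_derive_minus F G z H1 H2). Qed.

Lemma Cdiff_translate F c z : Cdiff F (Cplus c z) -> Cdiff (fun w => F (Cplus c w)) z.
Proof.
  intros H. apply Cdiff_comp; auto.
  exact (ex_derive_plus (V := AbsRing_NormedModule C_AbsRing) (fun _ => c) (fun w => w) z
    (ex_derive_const _ _) (ex_derive_id _)).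
Qed.

Lemma Cdiff_reflect F z : Cdiff F (Copp z) -> Cdiff (fun w => F (Copp w)) z.
Proof.
  intros H. apply Cdiff_comp; auto.
  exact (ex_derive_opp (V := AbsRing_NormedModule C_AbsRing) (fun w => w) z (ex_derive_id _)).
Qed.

Lemma Cdiff_ext_loc F G z d : 0 < d -> (forall w, Cmod (Cminus w z) < d -> F w = G w) ->
  Cdiff F z -> Cdiff G z.
Proof.
  intros Hd H. apply ex_derive_ext_loc. exists (mkposreal d Hd). intros y Hy. now apply H.
Qed.

Lemma Cdiff_cont G z : Cdiff G z -> forall eps, 0 < eps -> exists d, 0 < d /\
  forall h, Cmod h < d -> Cmod (Cminus (G (Cplus z h)) (G z)) < eps.
Proof.
  intros [l Hl] eps He. destruct (proj1 (Cder_iff G z l) Hl 1 Rlt_0_1) as [d [Hd H]].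
  set (K := 1 + Cmod l). assert (HK : 0 < K) by (unfold K; generalize (Cmod_ge_0 l); lra).
  exists (Rmin d (eps / K)). split.
  { apply Rmin_glb_lt; auto. now apply Rdiv_lt_0_compat. }
  intros h Hh.
  assert (H1 : Cmod h < d) by (eapply Rlt_le_trans; [exact Hh | apply Rmin_l]).
  assert (H2 : Cmod h < eps / K) by (eapply Rlt_le_trans; [exact Hh | apply Rmin_r]).
  specialize (H h H1).
  replace (Cminus (G (Cplus z h)) (G z)) with
    (Cplus (Cminus (Cminus (G (Cplus z h)) (G z)) (Cmult l h)) (Cmult l h)) by ring.
  eapply Rle_lt_trans; [apply Cmod_triangle|]. rewrite Cmod_mult.
  apply Rmult_lt_compat_r with (r := K) in H2; auto.
  replace (eps / K * K) with eps in H2 by (field; lra). unfold K in H2. lra.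
Qed.

Lemma Ccont_of_Cmod (g : R -> C) x :
  (forall eps, 0 < eps -> exists d, 0 < d /\
    forall h, Rabs h < d -> Cmod (Cminus (g (x + h)) (g x)) < eps) -> Ccont g x.
Proof.
  intros H. apply filterlim_locally. intros eps.
  destruct (H eps (cond_pos eps)) as [d [Hd Hh]].
  exists (mkposreal d Hd). intros y Hy.
  apply C_NormedModule_mixin_compat1.
  specialize (Hh (y - x) Hy). rewrite Rplus_minus in Hh. exact Hh.
Qed.

Lemma Ccont_horizontal G x y : Cdiff G (x, y) -> Ccont (fun t => G (t, y)) x.
Proof.
  intros H. apply Ccont_of_Cmod. intros eps He.
  destruct (Cdiff_cont G _ H eps He) as [d [Hd Hh]]. exists d; split; auto.
  intros h Hlt. specialize (Hh (h, 0)).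
  replace (Cplus (x, y) (h, 0)) with (x + h, y) in Hh
    by (unfold Cplus; simpl; f_equal; ring).
  apply Hh. change (h, 0) with (RtoC h). now rewrite Cmod_R.
Qed.

Lemma Cmod_imag t : Cmod (0, t) = Rabs t.
Proof.
  unfold Cmod; simpl. replace (0 * (0 * 1) + t * (t * 1)) with (Rsqr t) by (unfold Rsqr; ring).
  apply sqrt_Rsqr_abs.
Qed.

Lemma Ccont_vertical G x y : Cdiff G (x, y) -> Ccont (fun t => G (x, t)) y.
Proof.
  intros H. apply Ccont_of_Cmod. intros eps He.
  destruct (Cdiff_cont G _ H eps He) as [d [Hd Hh]]. exists d; split; auto.
  intros h Hlt. specialize (Hh (0, h)).
  replace (Cplus (x, y) (0, h)) with (x, y + h) in Hh
    by (unfold Cplus; simpl; f_equal; ring).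
  apply Hh. now rewrite Cmod_imag.
Qed.

(* exp (2 pi i k z) *)
Definition cexp (k : Z) (z : C) : C :=
  Cmult (RtoC (exp (- (2 * PI * IZR k * snd z)))) (echar k (fst z)).

Lemma cexp_plus k z w : cexp k (Cplus z w) = Cmult (cexp k z) (cexp k w).
Proof.
  unfold cexp. simpl fst; simpl snd. rewrite echar_add_arg.
  replace (- (2 * PI * IZR k * (snd z + snd w))) with
    (- (2 * PI * IZR k * snd z) + - (2 * PI * IZR k * snd w)) by ring.
  rewrite exp_plus, RtoC_mult. ring.
Qed.

Lemma Cmod_le_Rabs (z : C) : Cmod z <= Rabs (fst z) + Rabs (snd z).
Proof.
  replace z with (Cplus (RtoC (fst z)) (0, snd z)) at 1
    by (destruct z; unfold Cplus, RtoC; simpl; f_equal; ring).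
  eapply Rle_trans; [apply Cmod_triangle|]. rewrite Cmod_R, Cmod_imag. lra.
Qed.

Lemma Rabs_fst_le (z : C) : Rabs (fst z) <= Cmod z.
Proof. eapply Rle_trans; [|apply Rmax_Cmod]. apply Rmax_l. Qed.

Lemma Rabs_snd_le (z : C) : Rabs (snd z) <= Cmod z.
Proof. eapply Rle_trans; [|apply Rmax_Cmod]. apply Rmax_r. Qed.

Lemma derivable_pt_lim_0_mult f l : derivable_pt_lim f 0 l -> forall eps, 0 < eps ->
  exists d, 0 < d /\ forall h, Rabs h < d -> Rabs (f h - f 0 - l * h) <= eps * Rabs h.
Proof.
  intros H eps He. destruct (H eps He) as [d Hd]. exists d. split; [apply cond_pos|].
  intros h Hh. destruct (Req_dec h 0) as [->|Hn].
  - rewrite Rabs_R0, Rmult_0_r, Rminus_0_r, Rminus_diag, Rabs_R0. lra.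
  - specialize (Hd h Hn Hh). rewrite Rplus_0_l in Hd.
    replace (f h - f 0 - l * h) with (((f h - f 0) / h - l) * h) by (field; auto).
    rewrite Rabs_mult. apply Rmult_le_compat_r; [apply Rabs_pos|]. lra.
Qed.

(** The expansion [exp (a + i b) = 1 + a + i b + o(|a| + |b|)] in real coordinates, from the
    derivatives of [exp], [cos] and [sin] at 0. *)
Lemma exp_cos_sin_first_order eps : 0 < eps -> exists d, 0 < d /\
  forall a b, Rabs a < d -> Rabs b < d ->
  Rabs (exp a * cos b - 1 - a) <= eps * (Rabs a + Rabs b) /\
  Rabs (exp a * sin b - b) <= eps * (Rabs a + Rabs b).
Proof.
  intros He. set (e := Rmin 1 (eps / 8)).
  assert (He0 : 0 < e) by (apply Rmin_glb_lt; lra).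
  assert (He1 : e <= 1) by apply Rmin_l. assert (He8 : e <= eps / 8) by apply Rmin_r.
  destruct (derivable_pt_lim_0_mult exp 1 derivable_pt_lim_exp_0 e He0) as [d1 [Hd1 H1]].
  assert (DC : derivable_pt_lim cos 0 0).
  { replace 0 with (- sin 0) at 2 by (rewrite sin_0; ring). apply derivable_pt_lim_cos. }
  assert (DS : derivable_pt_lim sin 0 1).
  { rewrite <- cos_0. apply derivable_pt_lim_sin. }
  destruct (derivable_pt_lim_0_mult cos 0 DC e He0) as [d2 [Hd2 H2]].
  destruct (derivable_pt_lim_0_mult sin 1 DS e He0) as [d3 [Hd3 H3]].
  rewrite exp_0 in H1. rewrite cos_0 in H2. rewrite sin_0 in H3.
  (* The bound [e / 2] gives [|exp a - 1| <= 2 |a| <= e] and [exp a <= 2]; the errors then add up to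
     at most [3 e (|a| + |b|)], and [e <= eps / 8]. *)
  exists (Rmin (Rmin d1 d2) (Rmin d3 (e / 2))). split.
  { repeat apply Rmin_glb_lt; lra. }
  intros a b Ha Hb.
  assert (Hm := Rmin_l (Rmin d1 d2) (Rmin d3 (e / 2))).
  assert (Hm' := Rmin_r (Rmin d1 d2) (Rmin d3 (e / 2))).
  generalize (Rmin_l d1 d2) (Rmin_r d1 d2) (Rmin_l d3 (e/2)) (Rmin_r d3 (e/2)); intros.
  specialize (H1 a ltac:(lra)). specialize (H2 b ltac:(lra)). specialize (H3 b ltac:(lra)).
  assert (Hpa := Rabs_pos a). assert (Hpb := Rabs_pos b).
  assert (Hea : Rabs (exp a - 1) <= 2 * Rabs a).
  { replace (exp a - 1) with ((exp a - 1 - 1 * a) + a) by ring.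
    eapply Rle_trans; [apply Rabs_triang|]. nra. }
  assert (Hexp : Rabs (exp a) <= 2).
  { replace (exp a) with (1 + (exp a - 1)) by ring.
    eapply Rle_trans; [apply Rabs_triang|]. rewrite Rabs_R1. lra. }
  split.
  - replace (exp a * cos b - 1 - a) with
      ((exp a - 1 - 1 * a) + exp a * (cos b - 1 - 0 * b)) by ring.
    eapply Rle_trans; [apply Rabs_triang|]. rewrite Rabs_mult.
    apply Rle_trans with (e * Rabs a + 2 * (e * Rabs b)).
    + apply Rplus_le_compat; auto. apply Rmult_le_compat; auto using Rabs_pos.
    + nra.
  - replace (exp a * sin b - b) with
      (exp a * (sin b - 0 - 1 * b) + (exp a - 1) * b) by ring.
    eapply Rle_trans; [apply Rabs_triang|]. rewrite !Rabs_mult.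
    apply Rle_trans with (2 * (e * Rabs b) + e * Rabs b).
    + apply Rplus_le_compat; apply Rmult_le_compat; auto using Rabs_pos. lra. lra.
    + nra.
Qed.

(** The functional equation moves the increment to 0, where the first order expansion applies with
    [a = - c Im h] and [b = c Re h]. *)
Lemma Cdiff_cexp k z : Cdiff (cexp k) z.
Proof.
  set (c := 2 * PI * IZR k).
  exists (Cmult (cexp k z) (0, c)). apply Cder_iff. intros eps He.
  set (m := Cmod (cexp k z)). assert (Hm : 0 <= m) by apply Cmod_ge_0.
  set (K := 4 * (m * (1 + Rabs c)) + 1).
  assert (Hmc : 0 <= m * (1 + Rabs c)).
  { apply Rmult_le_pos; auto. generalize (Rabs_pos c); lra. }
  assert (HK : 0 < K) by (unfold K; lra).
  destruct (exp_cos_sin_first_order (eps / K)) as [d [Hd H]].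
  { now apply Rdiv_lt_0_compat. }
  assert (Hc1 : 0 < 1 + Rabs c) by (generalize (Rabs_pos c); lra).
  exists (d / (1 + Rabs c)). split; [now apply Rdiv_lt_0_compat|].
  intros h Hh.
  assert (Hhc : (1 + Rabs c) * Cmod h < d).
  { apply Rmult_lt_compat_l with (r := 1 + Rabs c) in Hh; auto.
    replace ((1 + Rabs c) * (d / (1 + Rabs c))) with d in Hh by (field; lra). auto. }
  assert (Hf := Rabs_fst_le h). assert (Hs := Rabs_snd_le h).
  assert (Ha : Rabs (- (c * snd h)) <= (1 + Rabs c) * Cmod h).
  { rewrite Rabs_Ropp, Rabs_mult. apply Rmult_le_compat; auto using Rabs_pos; lra. }
  assert (Hb : Rabs (c * fst h) <= (1 + Rabs c) * Cmod h).
  { rewrite Rabs_mult. apply Rmult_le_compat; auto using Rabs_pos; lra. }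
  destruct (H (- (c * snd h)) (c * fst h)) as [H1 H2]; try lra.
  rewrite cexp_plus.
  replace (Cminus (Cminus (Cmult (cexp k z) (cexp k h)) (cexp k z)) (Cmult (Cmult (cexp k z) (0, c)) h))
   with (Cmult (cexp k z) (Cminus (Cminus (cexp k h) (RtoC 1)) (Cmult (0, c) h))) by ring.
  rewrite Cmod_mult. fold m.
  set (A := eps / K * (Rabs (- (c * snd h)) + Rabs (c * fst h))) in *.
  apply Rle_trans with (m * (A + A)).
  - apply Rmult_le_compat_l; auto.
    eapply Rle_trans; [apply Cmod_le_Rabs|].
    unfold cexp, echar, Cmult, Cminus, Cplus, Copp, RtoC; simpl. fold c.
    apply Rplus_le_compat.
    + eapply Rle_trans; [|apply H1]. right. f_equal. ring.
    + eapply Rle_trans; [|apply H2]. right. f_equal. ring.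
  - assert (HA : A <= eps / K * (2 * ((1 + Rabs c) * Cmod h))).
    { apply Rmult_le_compat_l; [|lra]. apply Rlt_le, Rdiv_lt_0_compat; auto. }
    apply Rle_trans with (m * (4 * (eps / K * ((1 + Rabs c) * Cmod h)))).
    + apply Rmult_le_compat_l; auto. lra.
    + replace (m * (4 * (eps / K * ((1 + Rabs c) * Cmod h))))
        with (eps * Cmod h * ((K - 1) / K)) by (unfold K; field; unfold K in HK; lra).
      rewrite <- (Rmult_1_r (eps * Cmod h)) at 2.
      apply Rmult_le_compat_l. apply Rmult_le_pos; [lra|apply Cmod_ge_0].
      apply Rmult_le_reg_r with K; auto. unfold Rdiv. rewrite Rmult_assoc, Rinv_l; lra.
Qed.

(** * Goursat's theorem on rectangles *)

Definition holo_strip (G : C -> C) (al be : R) : Prop :=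
  forall z : C, al < snd z < be -> Cdiff G z.

(* The counterclockwise integral of [G] along the boundary of [x, x+w] x [y, y+v]. Opposite
   sides share an integral, so that affine functions have constant integrands. *)
Definition rect (G : C -> C) (x y w v : R) : C :=
  Cplus (CInt (fun t => Cminus (G (t, y)) (G (t, y + v))) x (x + w))
    (Cmult Ci (CInt (fun t => Cminus (G (x + w, t)) (G (x, t))) y (y + v))).

Lemma holo_strip_horizontal G al be y x : holo_strip G al be -> al < y < be ->
  Ccont (fun t => G (t, y)) x.
Proof. intros H Hy. now apply Ccont_horizontal, H. Qed.

Lemma holo_strip_vertical G al be x y : holo_strip G al be -> al < y < be ->
  Ccont (fun t => G (x, t)) y.
Proof. intros H Hy. now apply Ccont_vertical, H. Qed.

Lemma CInt_Chasles (f : R -> C) a b c : a <= b -> b <= c ->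
  (forall t, a <= t <= c -> Ccont f t) ->
  CInt f a c = Cplus (CInt f a b) (CInt f b c).
Proof.
  intros Hab Hbc H. symmetry. apply (RInt_Chasles (V := C_R_CompleteNormedModule));
    apply ex_CInt; intros t; rewrite Rmin_left, Rmax_right by auto; intros; apply H; lra.
Qed.

(** The horizontal part splits at [x + w1]. In the vertical part the common inner side is inserted,
    which the two halves traverse in opposite directions. *)
Lemma rect_split_x G al be x y w1 w2 v : holo_strip G al be ->
  al < y -> y + v < be -> 0 <= v -> 0 <= w1 -> 0 <= w2 ->
  rect G x y (w1 + w2) v = Cplus (rect G x y w1 v) (rect G (x + w1) y w2 v).
Proof.
  intros H Ha Hb Hv H1 H2. unfold rect. rewrite <- Rplus_assoc.
  assert (Hh : forall u t, al < u < be -> Ccont (fun t => G (t, u)) t)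
    by (intros; eapply holo_strip_horizontal; eauto).
  assert (Hv' : forall u t, y <= t <= y + v -> Ccont (fun t => G (u, t)) t)
    by (intros; eapply holo_strip_vertical; eauto; lra).
  rewrite (CInt_Chasles _ x (x + w1) (x + w1 + w2)); try lra.
  2:{ intros; apply Ccont_minus; apply Hh; lra. }
  rewrite (CInt_ext (fun t => Cminus (G (x + w1 + w2, t)) (G (x, t)))
    (fun t => Cplus (Cminus (G (x + w1 + w2, t)) (G (x + w1, t)))
                    (Cminus (G (x + w1, t)) (G (x, t))))) by (intros; ring).
  rewrite CInt_plus.
  ring.
  all: intros t; rewrite Rmin_left, Rmax_right by lra; intros; apply Ccont_minus; apply Hv'; lra.
Qed.

Lemma rect_split_y G al be x y w v1 v2 : holo_strip G al be ->
  al < y -> y + v1 + v2 < be -> 0 <= w -> 0 <= v1 -> 0 <= v2 ->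
  rect G x y w (v1 + v2) = Cplus (rect G x y w v1) (rect G x (y + v1) w v2).
Proof.
  intros H Ha Hb Hw H1 H2. unfold rect. rewrite <- Rplus_assoc.
  assert (Hh : forall u t, al < u < be -> Ccont (fun t => G (t, u)) t)
    by (intros; eapply holo_strip_horizontal; eauto).
  assert (Hv' : forall u t, y <= t <= y + v1 + v2 -> Ccont (fun t => G (u, t)) t)
    by (intros; eapply holo_strip_vertical; eauto; lra).
  rewrite (CInt_Chasles _ y (y + v1) (y + v1 + v2)); try lra.
  2:{ intros; apply Ccont_minus; apply Hv'; lra. }
  rewrite (CInt_ext (fun t => Cminus (G (t, y)) (G (t, y + v1 + v2)))
    (fun t => Cplus (Cminus (G (t, y)) (G (t, y + v1)))
                    (Cminus (G (t, y + v1)) (G (t, y + v1 + v2))))) by (intros; ring).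
  rewrite CInt_plus.
  ring.
  all: intros t; rewrite Rmin_left, Rmax_right by lra; intros; apply Ccont_minus; apply Hh; lra.
Qed.

(** The asymmetric form matches [bad_corner], which falls back on the last quarter when the other
    three tests fail. *)
Lemma rect_quarter G al be x y w v c : holo_strip G al be ->
  al < y -> y + (v + v) < be -> 0 <= w -> 0 <= v ->
  4 * c < Cmod (rect G x y (w + w) (v + v)) ->
  Cmod (rect G x y w v) <= c -> Cmod (rect G (x + w) y w v) <= c ->
  Cmod (rect G x (y + v) w v) <= c -> c < Cmod (rect G (x + w) (y + v) w v).
Proof.
  intros H Ha Hb Hw Hv Hc H1 H2 H3.
  rewrite (rect_split_x G al be) in Hc by (auto; lra).
  rewrite !(rect_split_y G al be) in Hc by (auto; lra).
  generalize (Cmod_triangle (Cplus (rect G x y w v) (rect G x (y + v) w v))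
    (Cplus (rect G (x + w) y w v) (rect G (x + w) (y + v) w v)))
   (Cmod_triangle (rect G x y w v) (rect G x (y + v) w v))
   (Cmod_triangle (rect G (x + w) y w v) (rect G (x + w) (y + v) w v)). lra.
Qed.

Lemma CInt_near_const (f : R -> C) (c : C) (a b M : R) : a <= b ->
  (forall t, a <= t <= b -> Ccont f t) ->
  (forall t, a <= t <= b -> Cmod (Cminus (f t) c) <= M) ->
  Cmod (Cminus (CInt f a b) (Cmult (RtoC (b - a)) c)) <= (b - a) * M.
Proof.
  intros Hab Hf H.
  assert (E : CInt (fun _ => c) a b = Cmult (RtoC (b - a)) c).
  { rewrite (CInt_ext _ (fun t => Cmult c (RtoC 1))) by (intros; ring).
    rewrite CInt_scal by (intros; ccont).
    rewrite CInt_RtoC by (intros; rcont).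
    rewrite RInt_const. unfold scal; simpl; unfold mult; simpl.
    rewrite Rmult_1_r. ring. }
  rewrite <- E, <- CInt_minus.
  - apply Rle_trans with (RInt (fun _ => M) a b).
    + apply Cmod_CInt_le; auto. intros; apply Ccont_minus; auto; ccont. intros; rcont.
    + right. rewrite RInt_const. reflexivity.
  - rewrite Rmin_left, Rmax_right by auto. auto.
  - intros; ccont.
Qed.

(** For an affine function of slope [l] the differences of opposite sides are the constants
    [- i l v] and [l w], whose contributions [- i l v w] and [i l w v] cancel. What remains comes
    from the deviation, at most [2 M] for each pair of sides. *)
Lemma rect_near_affine G al be x y w v (a l p : C) M : holo_strip G al be ->
  al < y -> y + v < be -> 0 <= w -> 0 <= v ->
  (forall s t, x <= s <= x + w -> y <= t <= y + v ->
     Cmod (Cminus (G (s, t)) (Cplus a (Cmult l (Cminus (s, t) p)))) <= M) ->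
  Cmod (rect G x y w v) <= 2 * M * (w + v).
Proof.
  intros H Ha Hb Hw Hv HM.
  assert (Hd : forall z1 z2 A1 A2 : C, Cmod (Cminus z1 A1) <= M -> Cmod (Cminus z2 A2) <= M ->
    Cmod (Cminus (Cminus z1 z2) (Cminus A1 A2)) <= 2 * M).
  { intros z1 z2 A1 A2 E1 E2.
    replace (Cminus (Cminus z1 z2) (Cminus A1 A2))
      with (Cplus (Cminus z1 A1) (Copp (Cminus z2 A2))) by ring.
    eapply Rle_trans; [apply Cmod_triangle|]. rewrite Cmod_opp. lra. }
  assert (B1 := CInt_near_const (fun t => Cminus (G (t, y)) (G (t, y + v)))
    (Cmult l (Cmult (Copp Ci) (RtoC v))) x (x + w) (2 * M)).
  assert (B2 := CInt_near_const (fun t => Cminus (G (x + w, t)) (G (x, t)))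
    (Cmult l (RtoC w)) y (y + v) (2 * M)).
  set (I1 := CInt (fun t => Cminus (G (t, y)) (G (t, y + v))) x (x + w)) in *.
  set (I2 := CInt (fun t => Cminus (G (x + w, t)) (G (x, t))) y (y + v)) in *.
  replace (x + w - x) with w in B1 by ring.
  replace (y + v - y) with v in B2 by ring.
  replace (rect G x y w v) with
    (Cplus (Cminus I1 (Cmult (RtoC w) (Cmult l (Cmult (Copp Ci) (RtoC v)))))
      (Cmult Ci (Cminus I2 (Cmult (RtoC v) (Cmult l (RtoC w))))))
    by (unfold rect; fold I1 I2; ring).
  eapply Rle_trans; [apply Cmod_triangle|]. rewrite Cmod_mult, Cmod_Ci.
  assert (Cmod (Cminus I1 (Cmult (RtoC w) (Cmult l (Cmult (Copp Ci) (RtoC v))))) <= w * (2 * M)).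
  { apply B1; [lra| |].
    - intros; apply Ccont_minus; eapply holo_strip_horizontal; eauto; lra.
    - intros t Ht.
      replace (Cmult l (Cmult (Copp Ci) (RtoC v))) with
       (Cminus (Cplus a (Cmult l (Cminus (t, y) p))) (Cplus a (Cmult l (Cminus (t, y + v) p)))).
      apply Hd; apply HM; lra.
      destruct a, l, p; unfold Cminus, Cplus, Cmult, Copp, Ci, RtoC; simpl; f_equal; ring. }
  assert (Cmod (Cminus I2 (Cmult (RtoC v) (Cmult l (RtoC w)))) <= v * (2 * M)).
  { apply B2; [lra| |].
    - intros; apply Ccont_minus; eapply holo_strip_vertical; eauto; lra.
    - intros t Ht.
      replace (Cmult l (RtoC w)) with
       (Cminus (Cplus a (Cmult l (Cminus (x + w, t) p))) (Cplus a (Cmult l (Cminus (x, t) p)))).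
      apply Hd; apply HM; lra.
      destruct a, l, p; unfold Cminus, Cplus, Cmult, Copp, Ci, RtoC; simpl; f_equal; ring. }
  lra.
Qed.

(** Every left end lies below every right end, so the supremum of the left ends is a common
    point. *)
Lemma nested_dyadic_point (a : nat -> R) (w : R) : 0 <= w ->
  (forall n, a n <= a (S n) /\ a (S n) + w / 2 ^ S n <= a n + w / 2 ^ n) ->
  exists p, forall n, a n <= p <= a n + w / 2 ^ n.
Proof.
  intros Hw H.
  assert (Hpos : forall n, 0 <= w / 2 ^ n).
  { intros n. apply Rmult_le_pos; auto. apply Rlt_le, Rinv_0_lt_compat, pow_lt; lra. }
  assert (Hm : forall n k, a n <= a (n + k)%nat /\ a (n + k)%nat + w / 2 ^ (n + k) <= a n + w / 2 ^ n).
  { intros n k. induction k as [|k IH].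
    - rewrite Nat.add_0_r. lra.
    - rewrite Nat.add_succ_r. destruct (H (n + k)%nat). lra. }
  assert (Hmn : forall m n, a m <= a n + w / 2 ^ n).
  { intros m n. destruct (Nat.le_ge_cases m n) as [E|E].
    - replace n with (m + (n - m))%nat by lia. destruct (Hm m (n - m)%nat).
      generalize (Hpos (m + (n - m))%nat). lra.
    - replace m with (n + (m - n))%nat by lia. destruct (Hm n (m - n)%nat).
      generalize (Hpos (n + (m - n))%nat). lra. }
  destruct (completeness (fun r => exists n, r = a n)) as [p [Hp1 Hp2]].
  - exists (a 0%nat + w / 2 ^ 0). intros r [n ->]. apply Hmn.
  - exists (a 0%nat), 0%nat. auto.
  - exists p. intros n. split.
    + apply Hp1. now exists n.
    + apply Hp2. intros r [m ->]. apply Hmn.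
Qed.

(* Lower left corners of nested dyadic quarters on which the integral stays above [c / 4 ^ n]. *)
Fixpoint bad_corner (G : C -> C) (c x y w v : R) (n : nat) : R * R :=
  match n with
  | O => (x, y)
  | S m =>
    let (a, b) := bad_corner G c x y w v m in
    let w' := w / 2 ^ n in
    let v' := v / 2 ^ n in
    let bad s t := Rlt_dec (c / 4 ^ n) (Cmod (rect G s t w' v')) in
    if bad a b then (a, b) else if bad (a + w') b then (a + w', b)
    else if bad a (b + v') then (a, b + v') else (a + w', b + v')
  end.

Lemma half_pow (w : R) n : w / 2 ^ n = w / 2 ^ S n + w / 2 ^ S n.
Proof. simpl. field. apply pow_nonzero; lra. Qed.

Lemma bad_corner_step G c x y w v n :
  0 <= w -> 0 <= v ->
  let p := bad_corner G c x y w v n in let q := bad_corner G c x y w v (S n) in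
  (fst p <= fst q /\ fst q + w / 2 ^ S n <= fst p + w / 2 ^ n) /\
  (snd p <= snd q /\ snd q + v / 2 ^ S n <= snd p + v / 2 ^ n).
Proof.
  intros Hw Hv p q.
  assert (H2 : 0 <= / 2 ^ S n) by (apply Rlt_le, Rinv_0_lt_compat, pow_lt; lra).
  assert (0 <= w / 2 ^ S n) by (apply Rmult_le_pos; auto).
  assert (0 <= v / 2 ^ S n) by (apply Rmult_le_pos; auto).
  rewrite (half_pow w n), (half_pow v n).
  unfold q. cbn [bad_corner]. fold p. destruct p as [a b]. cbn [fst snd].
  repeat destruct Rlt_dec; cbn [fst snd]; lra.
Qed.

Lemma bad_corner_bad G al be c x y w v : holo_strip G al be ->
  al < y -> y + v < be -> 0 <= w -> 0 <= v -> c < Cmod (rect G x y w v) ->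
  forall n, let p := bad_corner G c x y w v n in
  y <= snd p /\ snd p + v / 2 ^ n <= y + v /\
  c / 4 ^ n < Cmod (rect G (fst p) (snd p) (w / 2 ^ n) (v / 2 ^ n)).
Proof.
  intros H Ha Hb Hw Hv Hc n. induction n as [|n IH].
  - simpl. unfold Rdiv. rewrite !Rinv_1, !Rmult_1_r. lra.
  - destruct (bad_corner_step G c x y w v n Hw Hv) as [_ [S1 S2]].
    simpl in IH. destruct IH as (I1 & I2 & I3).
    intros q. split; [unfold q; lra|]. split; [unfold q; lra|].
    assert (H2 : 0 <= / 2 ^ S n) by (apply Rlt_le, Rinv_0_lt_compat, pow_lt; lra).
    assert (0 <= w / 2 ^ S n) by (apply Rmult_le_pos; auto).
    assert (0 <= v / 2 ^ S n) by (apply Rmult_le_pos; auto).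
    unfold q. cbn [bad_corner].
    destruct (bad_corner G c x y w v n) as [a b]. cbn [fst snd] in *.
    destruct Rlt_dec as [|N1]; [auto|]. destruct Rlt_dec as [|N2]; [auto|].
    destruct Rlt_dec as [|N3]; [auto|].
    cbn [fst snd].
    apply (rect_quarter G al be); try (apply Rnot_lt_le; assumption); auto.
    + lra.
    + rewrite <- half_pow. lra.
    + rewrite <- !half_pow.
      replace (4 * (c / 4 ^ S n)) with (c / 4 ^ n); auto.
      simpl; field. apply pow_nonzero; lra.
Qed.

Lemma pow_2_small d K : 0 < d -> 0 <= K -> exists n, K / 2 ^ n < d.
Proof.
  intros Hd HK. destruct (pow_lt_1_zero (/ 2)) with (d / (K + 1)) as [n Hn].
  { rewrite Rabs_pos_eq; lra. } { apply Rdiv_lt_0_compat; lra. }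
  exists n. specialize (Hn n (Nat.le_refl n)).
  assert (0 < (/ 2) ^ n) by (apply pow_lt; lra).
  rewrite Rabs_pos_eq in Hn by lra. rewrite pow_inv in *.
  apply Rmult_lt_compat_r with (r := K + 1) in Hn; [|lra].
  replace (d / (K + 1) * (K + 1)) with d in Hn by (field; lra). unfold Rdiv. nra.
Qed.

(** On the n-th bad quarter the affine approximation at the common point [p] has error at most
    [eps K / 2^n] and the side lengths add up to [K / 2^n]. The integral is thus at most
    [2 K^2 eps / 4^n], against the lower bound [c / 4^n]. *)
Lemma Goursat G al be x y w v : holo_strip G al be ->
  al < y -> y + v < be -> 0 <= w -> 0 <= v -> rect G x y w v = RtoC 0.
Proof.
  intros H Ha Hb Hw Hv.
  destruct (Req_dec (Cmod (rect G x y w v)) 0) as [E|E]; [now apply Cmod_eq_0|].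
  (* Half the modulus, so that the strict inequality holds on the initial rectangle. *)
  exfalso. set (c := Cmod (rect G x y w v) / 2).
  assert (Hc : 0 < c) by (unfold c; generalize (Cmod_ge_0 (rect G x y w v)); lra).
  assert (Hbad := bad_corner_bad G al be c x y w v H Ha Hb Hw Hv ltac:(unfold c; unfold c in Hc; lra)).
  destruct (nested_dyadic_point (fun n => fst (bad_corner G c x y w v n)) w Hw) as [p1 Hp1].
  { intros n. apply bad_corner_step; auto. }
  destruct (nested_dyadic_point (fun n => snd (bad_corner G c x y w v n)) v Hv) as [p2 Hp2].
  { intros n. apply bad_corner_step; auto. }
  assert (Hp : al < p2 < be).
  { destruct (Hbad O) as (B1 & B2 & _). specialize (Hp2 O). simpl in *. lra. }
  destruct (H (p1, p2) Hp) as [l Hl].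
  set (K := w + v). assert (HK : 0 <= K) by (unfold K; lra).
  (* Chosen so that [2 K^2 eps <= c]; the summand 1 covers a degenerate rectangle with [K = 0]. *)
  destruct (proj1 (Cder_iff _ _ _) Hl (c / (2 * K ^ 2 + 1))) as [d [Hd Hder]].
  { apply Rdiv_lt_0_compat; nra. }
  set (eps := c / (2 * K ^ 2 + 1)) in *.
  assert (He : 0 < eps) by (apply Rdiv_lt_0_compat; nra).
  destruct (pow_2_small d K Hd HK) as [n Hn].
  destruct (Hbad n) as (B1 & B2 & B3).
  specialize (Hp1 n). specialize (Hp2 n). simpl in Hp1, Hp2.
  set (a := fst (bad_corner G c x y w v n)) in *.
  set (b := snd (bad_corner G c x y w v n)) in *.
  assert (Hi : 0 <= / 2 ^ n) by (apply Rlt_le, Rinv_0_lt_compat, pow_lt; lra).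
  assert (0 <= w / 2 ^ n) by (apply Rmult_le_pos; auto).
  assert (0 <= v / 2 ^ n) by (apply Rmult_le_pos; auto).
  assert (EK : K / 2 ^ n = w / 2 ^ n + v / 2 ^ n) by (unfold K, Rdiv; ring).
  assert (HR : Cmod (rect G a b (w / 2 ^ n) (v / 2 ^ n)) <=
     2 * (eps * (K / 2 ^ n)) * (w / 2 ^ n + v / 2 ^ n)).
  { apply (rect_near_affine G al be _ _ _ _ (G (p1, p2)) l (p1, p2)); auto; try lra.
    intros s t Hs Ht.
    set (h := Cminus (s, t) (p1, p2)).
    assert (Hh : Cmod h <= K / 2 ^ n).
    { rewrite EK. eapply Rle_trans; [apply Cmod_le_Rabs|]. unfold h; simpl.
      apply Rplus_le_compat; apply Rabs_le; lra. }
    specialize (Hder h ltac:(lra)).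
    replace (Cplus (p1, p2) h) with (s, t) in Hder
      by (unfold h, Cplus, Cminus, Copp; simpl; f_equal; ring).
    replace (Cminus (G (s, t)) (Cplus (G (p1, p2)) (Cmult l h)))
      with (Cminus (Cminus (G (s, t)) (G (p1, p2))) (Cmult l h)) by ring.
    eapply Rle_trans; [exact Hder|]. apply Rmult_le_compat_l; lra. }
  rewrite <- EK in HR.
  replace (2 * (eps * (K / 2 ^ n)) * (K / 2 ^ n)) with (2 * K ^ 2 * eps / 4 ^ n) in HR.
  2:{ replace 4 with (2 * 2) by ring. rewrite Rpow_mult_distr. field. apply pow_nonzero; lra. }
  assert (2 * K ^ 2 * eps <= c).
  { unfold eps. apply Rmult_le_reg_r with (2 * K ^ 2 + 1); [nra|].
    replace (2 * K ^ 2 * (c / (2 * K ^ 2 + 1)) * (2 * K ^ 2 + 1)) with (2 * K ^ 2 * c) by (field; nra).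
    nra. }
  assert (2 * K ^ 2 * eps / 4 ^ n <= c / 4 ^ n).
  { apply Rmult_le_compat_r; auto. apply Rlt_le, Rinv_0_lt_compat, pow_lt; lra. }
  lra.
Qed.

Lemma periodic_contour_shift G al be y v : holo_strip G al be ->
  al < y -> y + v < be -> 0 <= v ->
  (forall t, y <= t <= y + v -> G (1, t) = G (0, t)) ->
  CInt (fun t => G (t, y)) 0 1 = CInt (fun t => G (t, y + v)) 0 1.
Proof.
  intros H Ha Hb Hv Hper. apply Cminus_0.
  assert (HG := Goursat G al be 0 y 1 v H Ha Hb ltac:(lra) Hv).
  unfold rect in HG. rewrite Rplus_0_l in HG.
  rewrite CInt_minus in HG by (intros; eapply holo_strip_horizontal; eauto; lra).
  replace (CInt (fun t => Cminus (G (1, t)) (G (0, t))) y (y + v)) with (RtoC 0) in HG.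
  { rewrite <- HG. ring. }
  symmetry. transitivity (CInt (fun _ => RtoC 0) y (y + v)).
  - apply (RInt_ext (V := C_R_CompleteNormedModule) (fun t => Cminus (G (1, t)) (G (0, t)))
      (fun _ => RtoC 0)).
    intros t. rewrite Rmin_left, Rmax_right by lra. intros Ht.
    rewrite Hper by lra. unfold Cminus. apply Cplus_opp_r.
  - rewrite CInt_RtoC by (intros; rcont). f_equal. rewrite RInt_const. apply (Rmult_0_r (y + v - y)).
Qed.

(** * Unique continuation and decay of Fourier coefficients *)

Lemma cexp_period k x y : cexp k (x + 1, y) = cexp k (x, y).
Proof. unfold cexp; simpl. now rewrite echar_period. Qed.

Lemma polar_form (z : C) : z <> RtoC 0 -> exists t, z = Cmult (RtoC (Cmod z)) (echar 1 t).
Proof.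
  intros Hz. apply Cmod_gt_0 in Hz. assert (HP := PI_RGT_0).
  set (r := Cmod z) in *. set (a := fst z / r). set (b := snd z / r).
  assert (Hab : a ^ 2 + b ^ 2 = 1).
  { unfold a, b. replace ((fst z / r) ^ 2 + (snd z / r) ^ 2) with
      ((fst z ^ 2 + snd z ^ 2) / r ^ 2) by (field; lra).
    rewrite <- Cmod2. fold r. field; lra. }
  assert (Ha : -1 <= a <= 1) by nra.
  assert (Hth : exists th, cos th = a /\ sin th = b).
  { assert (Hs : sin (acos a) = sqrt (b ^ 2)).
    { rewrite sin_acos by auto. f_equal. unfold Rsqr. lra. }
    destruct (Rle_lt_dec 0 b) as [Hb|Hb].
    - exists (acos a). rewrite cos_acos, Hs, sqrt_pow2 by auto. auto.
    - exists (- acos a). rewrite cos_neg, sin_neg, cos_acos, Hs by auto.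
      replace (b ^ 2) with ((- b) ^ 2) by ring. rewrite sqrt_pow2 by lra. lra. }
  destruct Hth as [th [Hc Hs]]. exists (th / (2 * PI)).
  unfold echar. replace (2 * PI * 1 * (th / (2 * PI))) with th by (field; lra).
  rewrite Hc, Hs. destruct z as [z1 z2]. unfold Cmult, RtoC, a, b; simpl. f_equal; field; lra.
Qed.

(* In the coordinate [z = z0 + exp (2 pi i w)] circles become horizontal lines, so the
   Fourier coefficients of [H] on a circle of radius [r], divided by [r ^ k], do not
   depend on [r]; they vanish for small [r]. *)
Lemma holo_disc_zero (H : C -> C) (z0 : C) (r0 rad : R) : 0 < r0 ->
  (forall z, Cmod (Cminus z z0) < rad -> Cdiff H z) ->
  (forall z, Cmod (Cminus z z0) < r0 -> H z = RtoC 0) ->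
  forall z, Cmod (Cminus z z0) < rad -> H z = RtoC 0.
Proof.
  intros Hr0 Hd H0 z Hz.
  destruct (Rlt_le_dec (Cmod (Cminus z z0)) r0) as [Hs|Hs]; [auto|].
  assert (Hne : Cminus z z0 <> RtoC 0) by (apply Cmod_gt_0; lra).
  destruct (polar_form _ Hne) as [th Hth].
  set (r := Cmod (Cminus z z0)) in *.
  assert (HP := PI_RGT_0).
  (* The height at which [exp (2 pi i w)] has modulus [u]; larger circles correspond to lower
     lines. *)
  set (lv := fun u => - ln u / (2 * PI)).
  assert (Elv : forall u, 0 < u -> exp (- (2 * PI * 1 * lv u)) = u).
  { intros u Hu. unfold lv. replace (- (2 * PI * 1 * (- ln u / (2 * PI)))) with (ln u) by (field; lra).
    now apply exp_ln. }
  assert (Hlv : forall u w, 0 < u -> u < w -> lv w < lv u).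
  { intros u w Hu Huw. apply Rmult_lt_compat_r. apply Rinv_0_lt_compat; lra.
    apply Ropp_lt_contravar, ln_increasing; auto. }
  assert (Hcx : forall t u, 0 < u -> cexp 1 (t, lv u) = Cmult (RtoC u) (echar 1 t)).
  { intros t u Hu. unfold cexp; cbn [fst snd]. now rewrite Elv. }
  set (ps := fun k w => Cmult (H (Cplus z0 (cexp 1 w))) (cexp (- k) w)).
  (* The contour moves from radius [r] to [r0 / 2], where [H] vanishes; [r0 / 4] only makes the
     strip open around that line. *)
  assert (Hps : forall k, holo_strip (ps k) (lv rad) (lv (r0 / 4))).
  { intros k w Hw. unfold ps. apply Cdiff_mult; [|apply Cdiff_cexp].
    apply (Cdiff_comp (fun v => H (Cplus z0 v)) (cexp 1)); [|apply Cdiff_cexp].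
    apply Cdiff_translate, Hd.
    replace (Cminus (Cplus z0 (cexp 1 w)) z0) with (cexp 1 w) by ring.
    unfold cexp. rewrite Cmod_mult, Cmod_echar, Cmod_R, Rabs_pos_eq, Rmult_1_r
      by apply Rlt_le, exp_pos.
    rewrite <- (Elv rad) by lra. apply exp_increasing.
    assert (2 * PI * lv rad < 2 * PI * snd w) by (apply Rmult_lt_compat_l; lra). lra. }
  set (u := fun t => H (Cplus z0 (Cmult (RtoC r) (echar 1 t)))).
  assert (Hu : cont_on_T u).
  { split.
    - intros t. unfold u.
      apply Ccont_ext with (fun t => (fun w => H (Cplus z0 (cexp 1 w))) (t, lv r)).
      { intros s. now rewrite Hcx by lra. }
      apply (Ccont_horizontal (fun w => H (Cplus z0 (cexp 1 w)))).
      apply (Cdiff_comp (fun v => H (Cplus z0 v)) (cexp 1)); [|apply Cdiff_cexp].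
      apply Cdiff_translate, Hd. rewrite Hcx by lra.
      replace (Cminus (Cplus z0 (Cmult (RtoC r) (echar 1 t))) z0) with
        (Cmult (RtoC r) (echar 1 t)) by ring.
      rewrite Cmod_mult, Cmod_echar, Cmod_R, Rabs_pos_eq; lra.
    - intros t. unfold u. now rewrite echar_period. }
  assert (Hfk : forall k, fourier u k = RtoC 0).
  { intros k.
    assert (Hsh := periodic_contour_shift (ps k) _ _ (lv r) (lv (r0 / 2) - lv r) (Hps k)).
    replace (lv r + (lv (r0 / 2) - lv r)) with (lv (r0 / 2)) in Hsh by ring.
    specialize (Hsh (Hlv r rad ltac:(lra) Hz)
      (Hlv (r0 / 4) (r0 / 2) ltac:(lra) ltac:(lra))
      ltac:(generalize (Hlv (r0 / 2) r ltac:(lra) ltac:(lra)); lra)).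
    rewrite (CInt_ext (fun t => ps k (t, lv (r0 / 2))) (fun _ => RtoC 0)) in Hsh.
    2:{ intros t. unfold ps. rewrite Hcx by lra. rewrite H0; [ring|].
        replace (Cminus (Cplus z0 (Cmult (RtoC (r0 / 2)) (echar 1 t))) z0) with
          (Cmult (RtoC (r0 / 2)) (echar 1 t)) by ring.
        rewrite Cmod_mult, Cmod_echar, Cmod_R, Rabs_pos_eq; lra. }
    rewrite (CInt_RtoC (fun _ => 0)) in Hsh by (intros; rcont).
    rewrite RInt_const in Hsh. unfold scal in Hsh; simpl in Hsh; unfold mult in Hsh; simpl in Hsh.
    rewrite Rmult_0_r in Hsh.
    (* This is [r^(-k)]. *)
    set (e := exp (- (2 * PI * IZR (- k) * lv r))).
    assert (He : 0 < e) by apply exp_pos.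
    rewrite (CInt_ext _ (fun t => Cmult (RtoC e) (Cmult (u t) (Cconj (echar k t))))) in Hsh.
    2:{ intros t. unfold ps. rewrite Hcx by lra. unfold cexp; cbn [fst snd].
        rewrite echar_opp. fold e. unfold u. ring. }
    rewrite CInt_scal in Hsh.
    2:{ intros. destruct Hu as [Hu _]. ccont. }
    assert (Hsh' := Hsh ltac:(intros t _; unfold ps;
      replace (1, t) with (0 + 1, t) by (f_equal; ring); now rewrite !cexp_period)).
    fold (fourier u k) in Hsh'.
    apply (f_equal (Cmult (RtoC (/ e)))) in Hsh'.
    rewrite Cmult_assoc, <- RtoC_mult, Rinv_l, Cmult_1_l in Hsh' by lra.
    rewrite Hsh'. ring. }
  (* With [T = 0] the sup bound says that a function with vanishing coefficients vanishes. *)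
  assert (Hz0 := Cmod_le_fourier_l1 u 0 Hu).
  apply Cmod_eq_0. apply Rle_antisym; [|apply Cmod_ge_0].
  replace z with (Cplus z0 (Cmult (RtoC r) (echar 1 th))) by (rewrite <- Hth; ring).
  apply Hz0. intros n.
  apply Rle_trans with (zsumR (fun _ => 0) n); [|rewrite zsumR_const; lra].
  apply zsumR_le. intros k _. rewrite Hfk, Cmod_0. lra.
Qed.

(* [F (z + 1) - F z], cut off to zero in the upper half plane, is still holomorphic because it
   vanishes on the real line. *)
Lemma periodic_strip_lower (F : C -> C) (rho0 : R) :
  (forall z, Rabs (snd z) < rho0 -> Cdiff F z) ->
  (forall t : R, F (RtoC (t + 1)) = F (RtoC t)) ->
  forall x y, - rho0 < y <= 0 -> F (x + 1, y) = F (x, y).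
Proof.
  intros HF Hper x y Hy.
  set (D := fun z => Cminus (F (Cplus (RtoC 1) z)) (F z)).
  set (H := fun z : C => if Rlt_dec 0 (snd z) then RtoC 0 else D z).
  assert (HD : forall z, Rabs (snd z) < rho0 -> Cdiff D z).
  { intros z Hz. apply Cdiff_minus; auto.
    apply Cdiff_translate, HF. simpl. now rewrite Rplus_0_l. }
  assert (HD0 : forall t, D (RtoC t) = RtoC 0).
  { intros t. unfold D. rewrite <- RtoC_plus, Rplus_comm, Hper. ring. }
  assert (HH : forall z, Rabs (snd z) < rho0 -> Cdiff H z).
  { intros z Hz. destruct (Rtotal_order (snd z) 0) as [Hs|[Hs|Hs]].
    - apply (Cdiff_ext_loc D H z (- snd z)); auto; [lra|].
      intros w Hw. unfold H. destruct Rlt_dec as [Hw0|]; auto.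
      generalize (Rabs_snd_le (Cminus w z)). simpl. intros HA.
      apply Rle_lt_trans with (2 := Hw), Rabs_def2 in HA. lra.
    - destruct z as [x0 y0]. simpl in Hs. subst y0.
      destruct (HD (x0, 0) Hz) as [l Hl].
      assert (Hder := proj1 (Cder_iff _ _ _) Hl).
      (* Along real increments [D] is constantly 0, so its complex derivative at a real point is 0.
         This agrees with the derivative of the zero branch, and the two branches glue. *)
      assert (El : l = RtoC 0).
      { apply Cmod_eq_0. apply Rle_antisym; [|apply Cmod_ge_0].
        apply le_epsilon. intros eps He. rewrite Rplus_0_l.
        destruct (Hder eps He) as [d [Hd Hdh]].
        specialize (Hdh (RtoC (d / 2))). rewrite Cmod_R, Rabs_pos_eq in Hdh by lra.
        specialize (Hdh ltac:(lra)). change (x0, 0) with (RtoC x0) in Hdh.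
        rewrite <- RtoC_plus, !HD0 in Hdh.
        replace (Cminus (Cminus (RtoC 0) (RtoC 0)) (Cmult l (RtoC (d / 2)))) with
          (Copp (Cmult l (RtoC (d / 2)))) in Hdh by ring.
        rewrite Cmod_opp, Cmod_mult, Cmod_R, Rabs_pos_eq in Hdh by lra.
        apply Rmult_le_reg_r in Hdh; lra. }
      subst l. exists (RtoC 0). apply Cder_iff. intros eps He.
      destruct (Hder eps He) as [d [Hd Hdh]]. exists d. split; auto.
      intros h Hh. specialize (Hdh h Hh).
      assert (E0 : H (x0, 0) = RtoC 0).
      { unfold H; simpl. destruct Rlt_dec; [reflexivity|apply HD0]. }
      rewrite E0. unfold H at 1. destruct Rlt_dec.
      + replace (Cminus (Cminus (RtoC 0) (RtoC 0)) (Cmult (RtoC 0) h)) with (RtoC 0) by ring.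
        rewrite Cmod_0. apply Rmult_le_pos; [lra|apply Cmod_ge_0].
      + rewrite (HD0 x0 : D (x0, 0) = RtoC 0) in Hdh. exact Hdh.
    - apply (Cdiff_ext_loc (fun _ => RtoC 0) H z (snd z)); auto.
      + intros w Hw. unfold H. destruct Rlt_dec as [|Hw0]; auto.
        generalize (Rabs_snd_le (Cminus w z)). simpl. intros HA.
        apply Rle_lt_trans with (2 := Hw), Rabs_def2 in HA. lra.
      + apply ex_derive_const. }
  (* The disc about [(x, s)] of radius [s] lies in the upper half plane, where [H] is 0. The one of
     radius [rho0 - s] stays in the strip and contains [(x, y)], because [s - y < rho0 - s] amounts
     to [2 s < rho0 + y]. *)
  set (s := (rho0 + y) / 4).
  assert (Hdist : Cmod (Cminus (x, y) (x, s)) = s - y).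
  { replace (Cminus (x, y) (x, s)) with (0, y - s)
      by (unfold Cminus, Cplus, Copp; simpl; f_equal; ring).
    rewrite Cmod_imag, Rabs_left1; unfold s; lra. }
  assert (Hz : H (x, y) = RtoC 0).
  { apply (holo_disc_zero H (x, s) s (rho0 - s)); try (unfold s; lra).
    - intros z Hz. apply HH.
      assert (HA := Rle_lt_trans _ _ _ (Rabs_snd_le (Cminus z (x, s))) Hz).
      simpl in HA. apply Rabs_def2 in HA. apply Rabs_def1; unfold s in *; lra.
    - intros z Hz.
      assert (HA := Rle_lt_trans _ _ _ (Rabs_snd_le (Cminus z (x, s))) Hz).
      simpl in HA. apply Rabs_def2 in HA. unfold H. destruct Rlt_dec; auto. lra.
    - rewrite Hdist. unfold s; lra. }
  unfold H in Hz. simpl in Hz. destruct Rlt_dec; [lra|].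
  apply Cminus_0. rewrite <- Hz. unfold D. f_equal. f_equal.
  unfold Cplus, RtoC; simpl; f_equal; ring.
Qed.

(** Moving the contour down to height [- y] produces the factor [exp (- 2 pi k y)], a gain for
    [k >= 0]. Negative [k] are reached later by reflection, so periodicity in the lower half of the
    strip suffices. *)
Lemma fourier_decay_pos (F : C -> C) (f : R -> C) (rho0 y : R) : cont_on_T f ->
  (forall z, Rabs (snd z) < rho0 -> Cdiff F z) -> (forall t, F (RtoC t) = f t) ->
  0 <= y < rho0 ->
  exists M, forall k, Cmod (fourier f k) <= M * exp (- (2 * PI * IZR k * y)).
Proof.
  intros [Hfc Hfp] HF Hf Hy.
  assert (Hper : forall x t, - rho0 < t <= 0 -> F (x + 1, t) = F (x, t)).
  { apply periodic_strip_lower; auto. intros t. rewrite !Hf. auto. }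
  assert (Hstrip : forall z, - rho0 < snd z < rho0 -> Cdiff F z).
  { intros z Hz. apply HF. apply Rabs_def1; lra. }
  assert (HFc : forall x, Ccont (fun t => F (t, - y)) x).
  { intros x. apply Ccont_horizontal, Hstrip. simpl. lra. }
  exists (RInt (fun t => Cmod (F (t, - y))) 0 1). intros k.
  set (G := fun z => Cmult (F z) (cexp (- k) z)).
  assert (HG : holo_strip G (- rho0) rho0).
  { intros z Hz. apply Cdiff_mult. now apply Hstrip. apply Cdiff_cexp. }
  assert (E := periodic_contour_shift G _ _ (- y) y HG ltac:(lra) ltac:(lra) ltac:(lra)).
  replace (- y + y) with 0 in E by ring.
  specialize (E ltac:(intros t Ht; unfold G;
     replace (1, t) with (0 + 1, t) by (f_equal; ring);
     rewrite cexp_period, Hper by lra; reflexivity)).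
  set (e := exp (- (2 * PI * IZR k * y))).
  rewrite (CInt_ext _ (fun t => Cmult (RtoC e) (Cmult (F (t, - y)) (echar (- k) t)))) in E.
  2:{ intros t. unfold G, cexp; cbn [fst snd].
      replace (- (2 * PI * IZR (- k) * - y)) with (- (2 * PI * IZR k * y))
        by (rewrite opp_IZR; ring). fold e. ring. }
  rewrite CInt_scal in E by (intros; apply Ccont_mult; [apply HFc | apply Ccont_echar]).
  replace (fourier f k) with (CInt (fun t => G (t, 0)) 0 1).
  2:{ apply CInt_ext. intros t. unfold G, cexp; cbn [fst snd].
      change (t, 0) with (RtoC t). rewrite Hf, echar_opp, Rmult_0_r, Ropp_0, exp_0. ring. }
  rewrite <- E, Cmod_mult, Cmod_R, Rabs_pos_eq by apply Rlt_le, exp_pos.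
  rewrite Rmult_comm. apply Rmult_le_compat_r. apply Rlt_le, exp_pos.
  apply Cmod_CInt_le; [lra | | |].
  - intros; apply Ccont_mult; [apply HFc | apply Ccont_echar].
  - intros; now apply continuous_Cmod.
  - intros. rewrite Cmod_mult, Cmod_echar. lra.
Qed.

Lemma cont_on_T_reflect f : cont_on_T f -> cont_on_T (fun x => f (- x)).
Proof.
  intros [Hc Hp]. split.
  - intros x. apply (continuous_comp (fun x : R => - x) f).
    apply (continuous_opp (V := R_NormedModule)), continuous_id. apply Hc.
  - intros x. rewrite <- (Hp (- (x + 1))). f_equal. ring.
Qed.

Lemma fourier_reflect f k : cont_on_T f ->
  fourier (fun x => f (- x)) k = fourier f (- k).
Proof.
  intros [Hc Hp]. unfold fourier.
  set (g := fun x => Cmult (f x) (Cconj (echar (- k) x))).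
  assert (Hg : forall x, Ccont g x) by (intros; unfold g; ccont).
  (* The substitution [x -> 1 - x] maps [0, 1] to itself, and periodicity removes the 1. *)
  assert (E := RInt_comp_lin (V := C_R_CompleteNormedModule) g (-1) 1 0 1).
  replace (-1 * 0 + 1) with 1 in E by ring. replace (-1 * 1 + 1) with 0 in E by ring.
  specialize (E (ex_CInt g 1 0 (fun x _ => Hg x))).
  rewrite <- (opp_RInt_swap (V := C_R_CompleteNormedModule) g) in E
    by (apply ex_CInt; auto).
  rewrite (CInt_ext _
    (fun x => Cmult (RtoC (-1)) (Cmult (f (- x)) (Cconj (echar k x))))) in E.
  2:{ intros x. unfold g. replace (-1 * x + 1) with (- x + 1) by ring.
      rewrite Hp, echar_period, echar_opp_arg, echar_opp.
      apply injective_projections; simpl; unfold scal; simpl; unfold mult; simpl; ring. }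
  rewrite CInt_scal in E.
  2:{ intros; apply Ccont_mult; [|ccont]. apply (cont_on_T_reflect f). now split. }
  set (J := CInt (fun x => Cmult (f (- x)) (Cconj (echar k x))) 0 1) in *.
  change (Cmult (RtoC (-1)) J = Copp (CInt g 0 1)) in E.
  assert (EJ : forall z : C, Copp (Cmult (RtoC (-1)) z) = z).
  { intros z. replace (-1) with (Ropp 1) by ring. rewrite RtoC_opp. ring. }
  assert (EO : forall z : C, Copp (Copp z) = z) by (intros; ring).
  rewrite <- (EJ J), E. apply EO.
Qed.

Lemma fourier_decay (f : R -> C) (rho0 y : R) : cont_on_T f -> analytic_strip f rho0 ->
  0 <= y < rho0 ->
  exists M, 0 <= M /\ forall k, Cmod (fourier f k) <= M * exp (- (2 * PI * IZR (Z.abs k) * y)).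
Proof.
  intros Hf [F [HF HFf]] Hy.
  assert (HF' : forall z, Rabs (snd z) < rho0 -> Cdiff F z).
  { intros z Hz. destruct (HF z Hz) as [l [_ Hl]]. exists l. split; [apply is_linear_scal_l|].
    exact Hl. }
  destruct (fourier_decay_pos F f rho0 y Hf HF' HFf Hy) as [M1 H1].
  (* The reflected function [F (- z)] supplies the coefficients of negative index. *)
  destruct (fourier_decay_pos (fun z => F (Copp z)) (fun x => f (- x)) rho0 y) as [M2 H2]; auto.
  - now apply cont_on_T_reflect.
  - intros z Hz. apply Cdiff_reflect, HF'. simpl. now rewrite Rabs_Ropp.
  - intros t. rewrite <- RtoC_opp. apply HFf.
  - exists (Rmax (Rmax M1 M2) 0). split; [apply Rmax_r|]. intros k.
    assert (H3 := Rmax_l M1 M2). assert (H4 := Rmax_r M1 M2).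
    assert (H5 := Rmax_l (Rmax M1 M2) 0).
    destruct (Z.abs_spec k) as [[_ ->]|[_ ->]].
    + eapply Rle_trans; [apply H1|]. apply Rmult_le_compat_r; [apply Rlt_le, exp_pos|]. lra.
    + specialize (H2 (- k)%Z). rewrite fourier_reflect, Z.opp_involutive in H2 by auto.
      eapply Rle_trans; [apply H2|]. apply Rmult_le_compat_r; [apply Rlt_le, exp_pos|]. lra.
Qed.

(** The geometric sum telescopes, as [P m - P (m + 1) = (1 - q) P m]. Each pair of terms is bounded
    by [2 M P (n + N)] instead of [2 M q P (n + N)], which gives up a factor [q]. *)
Lemma geom_tail_sum_le (F : Z -> R) (M a : R) (n N : nat) : 0 < a -> 0 <= M ->
  (forall k, F k <= M * exp (- (a * IZR (Z.abs k)))) ->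
  tail_sum F n N <= 2 * M / (1 - exp (- a)) * exp (- (a * INR n)).
Proof.
  intros Ha HM HF. set (q := exp (- a)).
  assert (Hq : 0 < q < 1).
  { split; [apply exp_pos|]. unfold q. rewrite <- exp_0. apply exp_increasing. lra. }
  set (P := fun m => exp (- (a * INR m))).
  assert (HP : forall m, P (S m) = q * P m).
  { intros m. unfold P, q. rewrite S_INR, <- exp_plus. f_equal. ring. }
  assert (HP0 : forall m, 0 < P m) by (intros; apply exp_pos).
  apply Rle_trans with (2 * M / (1 - q) * (P n - P (n + N)%nat)).
  - induction N as [|N IH].
    + rewrite Nat.add_0_r. unfold tail_sum; simpl. lra.
    + unfold tail_sum in *. cbn [rsum].
      assert (B : forall s, Z.abs s = Z.of_nat (S (n + N)) -> F s <= M * P (n + N)%nat).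
      { intros s Hs. eapply Rle_trans; [apply HF|]. rewrite Hs, <- INR_IZR_INZ.
        change (M * P (S (n + N)) <= M * P (n + N)%nat). rewrite HP.
        apply Rmult_le_compat_l; auto. generalize (HP0 (n + N)%nat). nra. }
      assert (B1 := B (Z.of_nat (S (n + N))) ltac:(lia)).
      assert (B2 := B (- Z.of_nat (S (n + N)))%Z ltac:(lia)).
      rewrite Nat.add_succ_r, HP.
      replace (2 * M / (1 - q) * (P n - q * P (n + N)%nat)) with
        (2 * M / (1 - q) * (P n - P (n + N)%nat) + 2 * (M * P (n + N)%nat)) by (field; lra).
      lra.
  - apply Rmult_le_compat_l. apply Rmult_le_pos; [lra|]. apply Rlt_le, Rinv_0_lt_compat; lra.
    change (exp (- (a * INR n))) with (P n). generalize (HP0 (n + N)%nat). lra.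
Qed.

Theorem theorem2p2 :
  forall (L : nat -> nat) (X : nat -> nat -> R) (tau : nat -> nat -> R) (A B : R),
  MZ_family L X tau A B ->
  let kappa := B / A in
  forall f : R -> C, cont_on_T f ->
  (* (i) *)
  (forall sigma : R, 1/2 < sigma -> in_Hsigma sigma f ->
     forall (n : nat) (p : R -> C), (1 <= n)%nat -> LS_solution L X tau f n p ->
       L2norm (fun x => Cminus (f x) (p x))
       <= / sqrt (sigma - 1/2) * sqrt (1 + kappa ^ 2) * Hnorm sigma f
          * Rpower (INR n) (- sigma + 1/2)) /\
  (* (ii) *)
  (forall rho0 : R, 0 < rho0 -> analytic_strip f rho0 ->
     forall rho : R, rho < rho0 ->
       exists (C0 : R) (N : nat), forall (n : nat) (p : R -> C),
         (N <= n)%nat -> (1 <= n)%nat -> LS_solution L X tau f n p ->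
         L2norm (fun x => Cminus (f x) (p x)) <= C0 * exp (- rho * INR n)).
Proof.
  intros L X tau A B HMZ kappa f Hf. split.
  - intros sigma Hs Hsob n p Hn HLS.
    eapply Rle_trans.
    + apply (error_le_tail L X tau A B f n p
       (/ sqrt (sigma - 1/2) * Hnorm sigma f * Rpower (INR n) (- sigma + 1/2))); auto.
      intros N. now apply sob_tail_sum_le.
    + right. unfold kappa. ring.
  - intros rho0 Hrho0 Han rho Hrho.
    (* As [rho] may be zero or negative, [rho0 / 2] keeps [y] positive and the geometric ratio below
       1. *)
    set (y := Rmax rho (rho0 / 2)).
    assert (Hy1 := Rmax_l rho (rho0 / 2) : rho <= y).
    assert (Hy2 := Rmax_r rho (rho0 / 2) : rho0 / 2 <= y).
    assert (Hy : 0 <= y < rho0).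
    { split; [lra|]. apply Rmax_lub_lt; lra. }
    destruct (fourier_decay f rho0 y Hf Han Hy) as [M [HM HMk]].
    set (a := 2 * PI * y).
    assert (HP : 1 < PI) by (generalize PI2_1; lra).
    assert (Ha : 0 < a) by (unfold a; apply Rmult_lt_0_compat; lra).
    (* The threshold is 0: the bound holds for every [n >= 1]. *)
    exists (2 * M / (1 - exp (- a)) * sqrt (1 + (B / A) ^ 2)), 0%nat.
    intros n p _ Hn HLS.
    eapply Rle_trans.
    + apply (error_le_tail L X tau A B f n p
        (2 * M / (1 - exp (- a)) * exp (- (a * INR n)))); auto.
      intros N. apply geom_tail_sum_le; auto. intros k.
      eapply Rle_trans; [apply HMk|]. right. unfold a. f_equal. f_equal. ring.
    + assert (Hq : exp (- a) < 1) by (rewrite <- exp_0; apply exp_increasing; lra).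
      rewrite Rmult_assoc, (Rmult_comm (exp _)), <- Rmult_assoc.
      apply Rmult_le_compat_l.
      * apply Rmult_le_pos; [|apply sqrt_pos].
        apply Rmult_le_pos; [lra|]. apply Rlt_le, Rinv_0_lt_compat; lra.
      (* The rate [a = 2 pi y] exceeds [y], which is at least [rho]. *)
      * assert (Hle : - (a * INR n) <= - rho * INR n).
        { assert (rho <= a) by (unfold a; nra). generalize (pos_INR n). nra. }
        destruct Hle as [Hlt| ->]; [|lra]. now apply Rlt_le, exp_increasing.
Qed.
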